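(* Let $\eta\in\mathbb{R}$, $\lambda>-1/2$, $\beta>-1/2$, $d=\lambda+\beta+i\eta$, and let $\Phi_n$ be the monic orthogonal polynomials on the unit circle with respect to the weight function $$w(\theta)=e^{-\eta\theta}[\sin^2(\theta/2)]^{\lambda}[\cos^2(\theta/2)]^{\beta},\qquad 0\le\theta\le2\pi.$$ Let $n\ge1$ be such that $\alpha_n\ne0$, and let $\varepsilon_n$ be given by $(d+n+1)\overline{\alpha}_n\varepsilon_n=(\overline d+n)\overline{\alpha}_{n-1}$. Then $$z(z+\varepsilon_n)(z^2-1)\Phi_n''(z)+p_3(z)\Phi_n'(z)-p_2(z)\Phi_n(z)=0,$$ where $$p_3(z)=[(d+3-n)z^2+2(\lambda-\beta)z+\overline d+n-1](z+\varepsilon_n)-z(z^2-1),$$ $$\begin{aligned} p_2(z)=&[n(d+2)z-(d+n+1)\ell_{n+1,n}-2n(\beta-\lambda)](z+\varepsilon_n)-nz^2\\ &+[\ell_{n+1,n}+(d+n)\overline{\alpha}_n\alpha_{n-1}]z+\overline d+n. \end{aligned}$$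
   Context: The monic orthogonal polynomials $\Phi_n$ ($\deg\Phi_n=n$) are orthogonal for $\langle f,g\rangle=\int_0^{2\pi}f(e^{i\theta})\overline{g(e^{i\theta})}\,w(\theta)\,d\theta$, and are written $\Phi_n(z)=z^n+\ell_{n,n-1}z^{n-1}+\cdots+\ell_{n,0}$. Verblunsky coefficients: $\alpha_{n-1}=-\overline{\Phi_n(0)}$ for $n\ge1$, and $\alpha_{-1}=-1$. Prime denotes $d/dz$. *)

(* Defs.v *)
From HB Require Import structures.
From mathcomp Require Export all_boot all_order all_algebra.
From mathcomp Require Export complex.
From mathcomp Require Export all_classical all_reals all_analysis.

Set Implicit Arguments.
Unset Strict Implicit.
Unset Printing Implicit Defensive.

Import Order.TTheory GRing.Theory Num.Theory.
Import numFieldNormedType.Exports.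

Local Open Scope classical_set_scope.
Local Open Scope ring_scope.
Local Open Scope complex_scope.

Definition expi (R : realType) (t : R) : R[i] := cos t +i* sin t.

(* At the endpoints and at t = pi a negative power evaluates to 0 rather than
   to infinity ([powR] is total); this only concerns a null set. *)
Definition weight (R : realType) (eta lambda beta t : R) : R :=
  expR (- eta * t) * (sin (t / 2) ^+ 2) `^ lambda * (cos (t / 2) ^+ 2) `^ beta.

(* Lebesgue integral over [0, 2 pi], taken on real and imaginary parts. *)
Definition cintegral (R : realType) (f : R -> R[i]) : R[i] :=
  (\int[lebesgue_measure]_(t in `[0, 2 * pi]) complex.Re (f t)) +i*
  (\int[lebesgue_measure]_(t in `[0, 2 * pi]) complex.Im (f t)).

Definition inner (R : realType) (w : R -> R) (f g : R[i] -> R[i]) : R[i] :=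
  cintegral (fun t => f (expi t) * (g (expi t))^* * (w t)%:C).

Definition monic_OPUC (R : realType) (w : R -> R) (Phi : nat -> {poly R[i]}) :=
  (forall n : nat, Phi n \is monic /\ size (Phi n) = n.+1) /\
  (forall m n : nat, m <> n -> inner w (horner (Phi m)) (horner (Phi n)) = 0).

(* Indices start at -1: the value at a negative index is the conventional
   alpha_{-1} = -1. *)
Definition verblunsky (R : realType) (Phi : nat -> {poly R[i]}) (k : int)
    : R[i] :=
  if k is Posz n then - ((Phi n.+1).[0])^* else - 1.

(* Main.v *)
(* Writing [z = exp (i t)], the weight satisfies a Pearson equation
   [(z^2 - 1) w' = i (d z^2 + 2 (lambda - beta) z + conj d) w], so integrating
   [sin t * f(t) * w(t)] by parts yields a linear identity for the inner
   product of the measure.  It shows that [z (z^2 - 1) Phi_n'] is orthogonal to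
   enough powers of [z] to be a combination of [Phi_n] and of the reversed
   polynomial [Phi_n^*], with coefficients of degree at most 2:
     [z (z^2 - 1) Phi_n' = (n z^2 + b z - (conj d + n)) Phi_n
        - ((d + n + 1) conj alpha_n z + (conj d + n) conj alpha_(n-1)) Phi_n^*].
   Reversing this relation gives a companion relation for [Phi_n^*].  As [Phi_n]
   has no zero at [z = 1] and [z = -1], the two relations force quadratic
   identities between the coefficients, and these are exactly what is needed to
   eliminate [Phi_n^*] and divide the result by [z^2 - 1]. *)
Require Import Defs.
From mathcomp Require Import measurable_realfun ring lra.

Set Implicit Arguments.
Unset Strict Implicit.
Unset Printing Implicit Defensive.

Import Order.TTheory GRing.Theory Num.Theory.
Import numFieldNormedType.Exports.
Local Open Scope ring_scope.

(** * Orthogonal polynomials for an abstract inner product *)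

(* Eliminating [Q] and [Q'] from the first-order system for [(P, Q)]; the
   relations [R1] and [R2] express that its residue matrices at [z = 1] and
   [z = -1] are singular, and make the result divisible by [z^2 - 1]. *)
Lemma second_order_elimination (A : comNzRingType)
    (z P P1 P2 Q Q1 n d ds b bs U V u v e : A) :
  z * (z ^+ 2 - 1) * P1 =
    (n * z ^+ 2 + b * z - (ds + n)) * P - (U * z + V) * Q ->
  (3 * z ^+ 2 - 1) * P1 + z * (z ^+ 2 - 1) * P2 =
    (2 * n * z + b) * P + (n * z ^+ 2 + b * z - (ds + n)) * P1
    - (U * Q + (U * z + V) * Q1) ->
  (z ^+ 2 - 1) * Q1 = (bs - d * z) * Q - (u + v * z) * P ->
  b * bs + d * ds = U * u + V * v ->
  b * d + bs * ds = - (U * v + V * u) ->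
  U * e = V ->
  (z ^+ 2 - 1) * (z * (z + e) * (z ^+ 2 - 1) * P2
    + (((d + 3 - n) * z ^+ 2 - (b + bs) * z + ds + n - 1) * (z + e)
       - z * (z ^+ 2 - 1)) * P1
    - ((n * (d + 2) * z + ((d + n + 1) * b + U * v) - n * (b + bs)) * (z + e)
       - n * z ^+ 2 - b * z + ds + n) * P) = 0.
Proof.
move=> S1 S1' S2 R1 R2 eV; rewrite -eV in S1 S1' R1 R2 *.
pose T1 := z * (z ^+ 2 - 1) * P1
  - ((n * z ^+ 2 + b * z - (ds + n)) * P - (U * z + U * e) * Q).
pose T1' := (3 * z ^+ 2 - 1) * P1 + z * (z ^+ 2 - 1) * P2
  - ((2 * n * z + b) * P + (n * z ^+ 2 + b * z - (ds + n)) * P1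
    - (U * Q + (U * z + U * e) * Q1)).
pose T2 := (z ^+ 2 - 1) * Q1 - ((bs - d * z) * Q - (u + v * z) * P).
pose E1 := b * bs + d * ds - (U * u + U * e * v).
pose E2 := b * d + bs * ds + (U * v + U * e * u).
(* The claim is a combination of the defects of the hypotheses: [T2] removes [Q1], the two multiples
   of [T1] remove [Q], and [E1], [E2] correct the remaining coefficient of [P]. *)
transitivity ((z + e) * (z ^+ 2 - 1) * T1' - (z ^+ 2 - 1) * T1
  - U * (z + e) ^+ 2 * T2 - (z + e) * (bs - d * z) * T1
  - (z + e) * (z * E1 - z ^+ 2 * E2) * P - (z ^+ 2 - 1) * (z + e) * E2 * P).
  by rewrite /T1 /T1' /T2 /E1 /E2; ring.
have -> : E2 = 0 by rewrite /E2 R2 addNr.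
have -> : E1 = 0 by rewrite /E1 R1 subrr.
have -> : T2 = 0 by rewrite /T2 S2 subrr.
have -> : T1' = 0 by rewrite /T1' S1' subrr.
have -> : T1 = 0 by rewrite /T1 S1 subrr.
ring.
Qed.

(** * Reversed polynomials *)

Section Reversal.
Variable C : numClosedFieldType.
Implicit Types (p q : {poly C}) (n : nat).

(** This is [z^n conj (p (1 / conj z))]. The degree [n] is a parameter because relations are also
    reversed at a degree above that of some of their terms. *)
Definition rev_conj n p : {poly C} := \poly_(i < n.+1) (p`_(n - i))^*.

Lemma coef_rev_conj n p i :
  (rev_conj n p)`_i = if (i <= n)%N then (p`_(n - i))^* else 0.
Proof. by rewrite coef_poly ltnS. Qed.

Lemma size_rev_conj n p : (size (rev_conj n p) <= n.+1)%N.
Proof. exact: size_poly. Qed.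

Lemma rev_conjD n p q : rev_conj n (p + q) = rev_conj n p + rev_conj n q.
Proof.
apply/polyP => i; rewrite coefD !coef_rev_conj coefD.
by case: ifP => _; rewrite ?addr0// rmorphD.
Qed.

Lemma rev_conjZ n a p : rev_conj n (a *: p) = a^* *: rev_conj n p.
Proof.
apply/polyP => i; rewrite coefZ !coef_rev_conj coefZ.
by case: ifP => _; rewrite ?mulr0// rmorphM.
Qed.

Lemma rev_conjN n p : rev_conj n (- p) = - rev_conj n p.
Proof. by rewrite -scaleN1r rev_conjZ rmorphN rmorph1 scaleN1r. Qed.

Lemma rev_conjS n p : (size p <= n.+1)%N ->
  rev_conj n.+1 p = 'X * rev_conj n p.
Proof.
move=> sp; apply/polyP => -[|i]; rewrite coefXM !coef_rev_conj/=.
  by rewrite subn0 nth_default// rmorph0.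
by rewrite ltnS subSS.
Qed.

Lemma rev_conjSX n p : rev_conj n.+1 ('X * p) = rev_conj n p.
Proof.
apply/polyP => i; rewrite !coef_rev_conj coefXM.
have [ilen|nlti] := leqP i n; first by rewrite leqW// subSn.
move: nlti; rewrite leq_eqVlt => /predU1P[<-|nlti].
  by rewrite leqnn subnn rmorph0.
by rewrite leqNgt nlti.
Qed.

Lemma rev_conjK n p : (size p <= n.+1)%N -> rev_conj n (rev_conj n p) = p.
Proof.
move=> sp; apply/polyP => i; rewrite !coef_rev_conj leq_subr.
have [ilen|nlti] := leqP i n; first by rewrite subKn// conjCK.
by rewrite nth_default// (leq_trans sp).
Qed.

Lemma coefX_deriv p i : ('X * p^`())`_i = i%:R * p`_i.
Proof.
rewrite coefXM coef_deriv; case: i => [|i]; first by rewrite mul0r.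
by rewrite /= mulr_natl.
Qed.

(** The operator ['X d/d'X] multiplies the coefficient of index [i] by [i], and reversal exchanges
    [i] with [n - i]. *)
Lemma rev_conj_deriv n p :
  rev_conj n ('X * p^`()) = n%:R *: rev_conj n p - 'X * (rev_conj n p)^`().
Proof.
apply/polyP => i; rewrite coefB coefZ coefX_deriv !coef_rev_conj coefX_deriv.
case: ifP => [ilen|_]; last by rewrite !mulr0 subr0.
by rewrite rmorphM rmorph_nat natrB// mulrBl.
Qed.

End Reversal.

(** * Orthogonality when multiplication by ['X] is an isometry *)

Section OPUC.
Variables (C : numClosedFieldType) (ip : {poly C} -> {poly C} -> C).
Implicit Types (p q r : {poly C}) (n : nat).
Hypothesis ipDl : forall p q r, ip (p + q) r = ip p r + ip q r.
Hypothesis ipZl : forall a p q, ip (a *: p) q = a * ip p q.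
Hypothesis ipC : forall p q, ip q p = (ip p q)^*.
Hypothesis ipX : forall p q, ip ('X * p) ('X * q) = ip p q.
Hypothesis ip_eq0 : forall p, ip p p = 0 -> p = 0.

Lemma ip0l p : ip 0 p = 0. Proof. by rewrite -(scale0r 0) ipZl mul0r. Qed.

Lemma ipNl p q : ip (- p) q = - ip p q.
Proof. by rewrite -scaleN1r ipZl mulN1r. Qed.

Lemma ipBl p q r : ip (p - q) r = ip p r - ip q r.
Proof. by rewrite ipDl ipNl. Qed.

Lemma ip_suml n (a : nat -> C) (f : nat -> {poly C}) q :
  ip (\sum_(i < n) a i *: f i) q = \sum_(i < n) a i * ip (f i) q.
Proof.
elim: n => [|n IH]; first by rewrite !big_ord0 ip0l.
by rewrite !big_ord_recr/= ipDl IH ipZl.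
Qed.

Lemma ip0r p : ip p 0 = 0. Proof. by rewrite ipC ip0l rmorph0. Qed.

Lemma ipDr p q r : ip p (q + r) = ip p q + ip p r.
Proof. by rewrite ipC ipDl rmorphD /= -!ipC. Qed.

Lemma ipZr a p q : ip p (a *: q) = a^* * ip p q.
Proof. by rewrite ipC ipZl rmorphM /= -ipC. Qed.

Lemma ipBr p q r : ip p (q - r) = ip p q - ip p r.
Proof. by rewrite ipDr -scaleN1r ipZr rmorphN rmorph1 mulN1r. Qed.

Lemma ip_sumr n (a : nat -> C) (f : nat -> {poly C}) q :
  ip q (\sum_(i < n) a i *: f i) = \sum_(i < n) (a i)^* * ip q (f i).
Proof.
rewrite ipC ip_suml rmorph_sum; apply: eq_bigr => i _.
by rewrite rmorphM /= -ipC.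
Qed.

Lemma ipXn k p q : ip ('X^k * p) ('X^k * q) = ip p q.
Proof. by elim: k => [|k IH]; rewrite ?expr0 ?mul1r// !exprS -!mulrA ipX. Qed.

Lemma poly_sumX n p : (size p <= n)%N -> p = \sum_(i < n) p`_i *: 'X^i.
Proof.
move=> sp; rewrite -(@poly_def _ n (fun i => p`_i)); apply/polyP => i.
rewrite coef_poly; case: ltnP => // ni.
by rewrite nth_default// (leq_trans sp).
Qed.

(** On the unit circle the reversal of [p] is [z^n conj p], which moves [p] to the other argument;
    the isometry gives this monomial by monomial. *)
Lemma ip_revl n p j : (size p <= n.+1)%N ->
  ip (rev_conj n p) 'X^j = ip 'X^n ('X^j * p).
Proof.
move=> sp; rewrite [in RHS](poly_sumX sp) mulr_sumr.
under [in RHS]eq_bigr do rewrite -scalerAr.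
rewrite (ip_sumr _ (fun i => p`_i) (fun i => 'X^j * 'X^i)).
rewrite /rev_conj poly_def.
rewrite (ip_suml _ (fun i => (p`_(n - i))^*) (fun i => 'X^i)).
rewrite (reindex_inj rev_ord_inj); apply: eq_bigr => i _ /=.
rewrite subSS subKn; last by rewrite -ltnS.
have -> : 'X^n = 'X^i * 'X^(n - i) :> {poly C}.
  by rewrite -exprD subnKC// -ltnS.
by rewrite ['X^j * _]mulrC ipXn.
Qed.

Variable Phi : nat -> {poly C}.
Hypothesis monicPhi : forall n, Phi n \is monic.
Hypothesis sizePhi : forall n, size (Phi n) = n.+1.
Hypothesis orthPhi : forall m n, m <> n -> ip (Phi m) (Phi n) = 0.

Lemma coefPhi n : (Phi n)`_n = 1.
Proof. by have := monicPhi n; rewrite monicE lead_coefE sizePhi => /eqP. Qed.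

Lemma size_subPhi n p : (size p <= n.+1)%N ->
  (size (p - p`_n *: Phi n)%R <= n)%N.
Proof.
move=> sp; apply/leq_sizeP => j; rewrite leq_eqVlt => /predU1P[<-|nj].
  by rewrite coefB coefZ coefPhi mulr1 subrr.
have Pj : (Phi n)`_j = 0 by rewrite nth_default// sizePhi.
by rewrite coefB coefZ Pj mulr0 subr0 nth_default// (leq_trans sp).
Qed.

Lemma ipPhi_low n p : (size p <= n)%N -> ip (Phi n) p = 0.
Proof.
(* The degree bound [k] is separated from [n], so that the induction expands [q] along [Phi k] while
   [Phi n] stays fixed. *)
suff low k q : (k <= n)%N -> (size q <= k)%N -> ip (Phi n) q = 0 by exact: low.
elim: k q => [|k IH] q kn sq.
  by move: sq; rewrite leqn0 size_poly_eq0 => /eqP ->; exact: ip0r.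
rewrite -(subrK (q`_k *: Phi k) q) ipDr IH ?size_subPhi ?(ltnW kn)// add0r ipZr.
by rewrite orthPhi ?mulr0// => nk; rewrite nk ltnn in kn.
Qed.

Lemma ipXnPhi_low n j : (j < n)%N -> ip (Phi n) 'X^j = 0.
Proof. by move=> jn; rewrite ipPhi_low// size_polyXn. Qed.

Let h n := ip (Phi n) (Phi n).

Lemma norm_real n : (h n)^* = h n. Proof. by rewrite /h -ipC. Qed.

Lemma norm_neq0 n : h n != 0.
Proof.
apply/eqP => /ip_eq0 P0.
by have := sizePhi n; rewrite P0 size_poly0.
Qed.

Lemma size_XnsubPhi n : (size ('X^n - Phi n)%R <= n)%N.
Proof.
have := @size_subPhi n 'X^n; rewrite coefXn eqxx scale1r; apply.
by rewrite size_polyXn.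
Qed.

Lemma ipPhi_Xn n : ip (Phi n) 'X^n = h n.
Proof.
by rewrite -(subrK (Phi n) 'X^n) ipDr ipPhi_low ?add0r// size_XnsubPhi.
Qed.

Lemma ipXn_Phi n : ip 'X^n (Phi n) = h n.
Proof. by rewrite ipC ipPhi_Xn norm_real. Qed.

(* [p] is divisible by ['X], and the quotient is orthogonal to itself. *)
Lemma ip_vanish n p : (size p <= n.+1)%N -> p`_0 = 0 ->
  (forall j, (j < n)%N -> ip p 'X^(j.+1) = 0) -> p = 0.
Proof.
move=> sp p0 hp.
have [q pq] : exists q, p = 'X * q.
  have /factor_theorem[q ->] : root p 0 by rewrite rootE horner_coef0 p0.
  by exists q; rewrite subr0 mulrC.
suff q0 : q = 0 by rewrite pq q0 mulr0.
apply: ip_eq0; have sq : (size q <= n)%N.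
  have [->|q0] := eqVneq q 0; first by rewrite size_poly0.
  by move: sp; rewrite pq mulrC size_mulX.
rewrite [X in ip _ X](poly_sumX sq) (ip_sumr _ (fun i => q`_i) (fun i => 'X^i)).
rewrite big1// => i _; rewrite -(ipX q) -exprS -pq hp ?mulr0//.
Qed.

(* For [Phi n = ('X - z) g], orthogonality to [g] gives
   [ip (Phi n) (Phi n) = (1 - |z|^2) ip g g]. *)
Lemma Phi_unit_circle n (z : C) : z * z^* = 1 -> (Phi n).[z] != 0.
Proof.
move=> zz; apply/negP => /factor_theorem[g Pg].
have := norm_neq0 n; rewrite /h.
have g0 : g != 0.
  by apply/eqP => g0; have := sizePhi n; rewrite Pg g0 mul0r size_poly0.
have sg : (size g <= n)%N.
  have := sizePhi n; rewrite Pg size_Mmonic ?monicXsubC// size_XsubC addn2.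
  by move=> -[->].
have Pg' : Phi n = 'X * g - z *: g by rewrite Pg -mul_polyC; ring.
have o := ipPhi_low sg.
have Xg : ip ('X * g) g = z * ip g g.
  by move: o; rewrite Pg' ipBl ipZl => /eqP; rewrite subr_eq0 => /eqP.
rewrite {2}Pg' ipBr ipZr o mulr0 subr0 Pg' ipBl ipZl ipX [ip g ('X * g)]ipC Xg.
by rewrite rmorphM /= -ipC mulrA zz mul1r subrr eqxx.
Qed.

(** * Szegő recursion and first-order relations at a fixed degree *)

Section FixedDegree.
Variable n : nat.
Hypothesis n_gt0 : (0 < n)%N.

Let P := Phi n.
Let Q := rev_conj n P.
(* [A] and [B] are the conjugates of [alpha_n] and [alpha_(n-1)]. *)
Let A := - (Phi n.+1)`_0.
Let B := - P`_0.
Let l := (Phi n.+1)`_n.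

Let sizeP : size P = n.+1. Proof. exact: sizePhi. Qed.
Let P0 : P`_0 = - B. Proof. by rewrite /B opprK. Qed.
Let Q0 : Q`_0 = 1. Proof. by rewrite coef_rev_conj subn0 coefPhi rmorph1. Qed.
Let Qn : Q`_n = - B^*.
Proof. by rewrite coef_rev_conj leqnn subnn P0 rmorphN. Qed.

Let ipQ j : ip Q 'X^j = ip 'X^n ('X^j * P).
Proof. by rewrite ip_revl ?sizeP. Qed.

(** The pairing becomes that of [P] with ['X^(n - j)], whose degree is below [n] since [j > 0]. *)
Let ipQ_low j : (0 < j)%N -> (j <= n)%N -> ip Q 'X^j = 0.
Proof.
move=> j0 jn; rewrite ipQ -(subnKC jn) exprD ipXn ipC ipXnPhi_low ?rmorph0//.
by rewrite ltn_subrL j0 n_gt0.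
Qed.

Let ipQ_1 : ip Q 1 = h n.
Proof. by have := ipQ 0; rewrite expr0 mul1r ipXn_Phi. Qed.

Let Psup j : (n < j)%N -> P`_j = 0.
Proof. by move=> nj; rewrite nth_default// sizeP. Qed.

Let Qsup j : (n < j)%N -> Q`_j = 0.
Proof. by move=> nj; rewrite coef_rev_conj leqNgt nj. Qed.

(** In the difference of the two sides the leading terms cancel, the constant term vanishes by the
    choice of [A], and both sides are orthogonal to ['X], ..., ['X^n]; so [ip_vanish] applies. *)
Lemma szego : Phi n.+1 = 'X * P - A *: Q.
Proof.
apply/eqP; rewrite -subr_eq0; apply/eqP; apply: (@ip_vanish n).
- apply/leq_sizeP => j; rewrite leq_eqVlt => /predU1P[<-|nj].
    rewrite !(coefB, coefZ, coefXM) coefPhi Qsup// coefPhi/= mulr0 subr0.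
    exact: subrr.
  rewrite !(coefB, coefZ, coefXM) Qsup ?(ltn_trans _ nj)//.
  case: j nj => // j; rewrite ltnS => nj /=; rewrite Psup// mulr0 !subr0.
  by rewrite nth_default// sizePhi.
- by rewrite !(coefB, coefZ, coefXM) Q0/= mulr1 sub0r opprK /A addrN.
- move=> j jn; rewrite !(ipBl, ipZl) exprS ipX -exprS.
  by rewrite ipXnPhi_low// ipXnPhi_low// ipQ_low// mulr0 !subr0.
Qed.

Let ipXP_1 : ip ('X * P) 1 = A * h n.
Proof.
have := @ipXnPhi_low n.+1 0 isT; rewrite szego ipBl ipZl expr0 ipQ_1.
by move/eqP; rewrite subr_eq0 => /eqP.
Qed.

Let lE : l = P`_n.-1 + A * B^*.
Proof.
rewrite /l szego !(coefB, coefZ, coefXM) Qn mulrN opprK.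
by move: n_gt0; case: n.
Qed.

Let hR : (h n)^* = h n. Proof. exact: norm_real. Qed.

Let ipP_XnS : ip P 'X^(n.+1) = - l^* * h n.
Proof.
(* The two top coefficients of ['X^(n.+1) - Phi n.+1 + l *: 'X^n] cancel, so [r] has degree below
   [n] and only [- l *: 'X^n] contributes to the pairing with [P]. *)
set r := 'X^(n.+1) - Phi n.+1 + l *: 'X^n.
have sr : (size r <= n)%N.
  apply/leq_sizeP => j; rewrite leq_eqVlt => /predU1P[<-|nj].
    rewrite !(coefB, coefD, coefZ, coefXn) eqxx mulr1 ltn_eqF//.
    by rewrite sub0r addNr.
  rewrite !(coefB, coefD, coefZ, coefXn) (gtn_eqF nj) mulr0 addr0.
  move: nj; rewrite leq_eqVlt => /predU1P[<-|nj].
    by rewrite eqxx coefPhi subrr.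
  by rewrite (gtn_eqF nj) nth_default ?subrr// sizePhi.
have -> : 'X^(n.+1) = r - l *: 'X^n + Phi n.+1 by rewrite addrK subrK.
rewrite ipDr ipBr ipZr (ipPhi_low sr) ipPhi_Xn orthPhi; last first.
  by move/eqP; rewrite ltn_eqF.
by rewrite addr0 sub0r mulNr.
Qed.

(* [d] stands for [lambda + beta + i eta] and [kap] for [lambda - beta]; the
   hypothesis is what integration by parts gives for the weight. *)
Variables d kap : C.
Hypothesis pearson : forall p q,
  ip (('X^2 - 1) * ('X * p^`())) q - ip (('X^2 - 1) * p) ('X * q^`())
  + ip (((d + 2)%:P * 'X^2 + (2 * kap)%:P * 'X + (d^*)%:P) * p) q = 0.

(** [T] is the defect of the first-order relation, and its coefficients are forced: [V] cancels the
    constant term of [T], [b] its coefficient of degree [n + 1], and [U] its pairing with ['X]. *)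
Let U := (d + n%:R + 1) * A.
Let V := (d^* + n%:R) * B.
Let b := - l - A * V^*.
Let T := ('X^2 - 1) * ('X * P^`())
  - ((n%:R *: 'X^2 + b *: 'X - (d^* + n%:R)%:P) * P)
  + (U *: 'X + V%:P) * Q.

Let VJ : V^* = (d + n%:R) * B^*.
Proof. by rewrite /V rmorphM rmorphD /= conjCK rmorph_nat. Qed.

(** For [q = 'X^(j.+1)] the operator ['X d/d'X] is multiplication by [j.+1], and the isometry
    reduces the other terms to pairings of [P] and ['X * P] with monomials. *)
Let pearsonP j : ip (('X^2 - 1) * ('X * P^`())) 'X^(j.+1) =
  j.+1%:R * (ip ('X * P) 'X^j - ip P 'X^(j.+1))
  - (d + 2) * ip ('X * P) 'X^j - 2 * kap * ip P 'X^j - d^* * ip P 'X^(j.+1).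
Proof.
have eX : 'X * ('X^(j.+1))^`() = j.+1%:R *: 'X^(j.+1) :> {poly C}.
  by rewrite derivXn -scaler_nat -scalerAr -exprS.
have X2 p : ip ('X^2 * p) 'X^(j.+1) = ip ('X * p) 'X^j.
  by rewrite expr2 -mulrA exprS ipX.
have X1 p : ip ('X * p) 'X^(j.+1) = ip p 'X^j by rewrite exprS ipX.
have := pearson P 'X^(j.+1).
have -> : ((d + 2)%:P * 'X^2 + (2 * kap)%:P * 'X + (d^*)%:P) * P =
    (d + 2) *: ('X^2 * P) + (2 * kap) *: ('X * P) + d^* *: P.
  by rewrite -!mul_polyC; ring.
have e2 : ip (('X^2 - 1) * P) 'X^(j.+1) = ip ('X * P) 'X^j - ip P 'X^(j.+1).
  by rewrite mulrBl mul1r ipBl X2.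
set x := ip (_ * ('X * _)) _.
rewrite eX ipZr rmorph_nat e2 !ipDl !ipZl X2 X1 => e.
apply/eqP; rewrite -subr_eq0 -[X in _ == X]e; apply/eqP; ring.
Qed.

(** Kept for every [j]: the cases [j < n] give [T = 0], after which [j = n] gives the value of
    [b + b^*]. *)
Let ipT j : ip T 'X^(j.+1) =
  (j.+1%:R - n%:R - (d + 2)) * ip ('X * P) 'X^j - (2 * kap + b) * ip P 'X^j
  + (n%:R - j.+1%:R) * ip P 'X^(j.+1)
  + U * ip Q 'X^j + V * ip Q 'X^(j.+1).
Proof.
have X2 p : ip ('X^2 * p) 'X^(j.+1) = ip ('X * p) 'X^j.
  by rewrite expr2 -mulrA exprS ipX.
have X1 p : ip ('X * p) 'X^(j.+1) = ip p 'X^j by rewrite exprS ipX.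
rewrite /T; have -> : (n%:R *: 'X^2 + b *: 'X - (d^* + n%:R)%:P) * P =
    n%:R *: ('X^2 * P) + b *: ('X * P) - (d^* + n%:R) *: P.
  by rewrite -!mul_polyC; ring.
have -> : (U *: 'X + V%:P) * Q = U *: ('X * Q) + V *: Q.
  by rewrite -!mul_polyC; ring.
rewrite !(ipDl, ipNl, ipZl) pearsonP !X2 !X1; ring.
Qed.

Let T_eq0 : T = 0.
Proof.
apply: (@ip_vanish n).
- have -> : T = 'X^2 * ('X * P^`() - n%:R *: P) - 'X * P^`() - b *: ('X * P)
      + (d^* + n%:R) *: P + U *: ('X * Q) + V *: Q.
    by rewrite /T -!mul_polyC; ring.
  (* Indices 0 and 1 are excluded by [n >= 1]. The choice of [b] settles degree [n + 1], the
     coefficient [n] of ['X^2] settles degree [n + 2]. *)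
  apply/leq_sizeP => -[|[|k]] nk; rewrite ?ltn0// in nk.
    by move: nk; rewrite ltnS leqNgt n_gt0.
  rewrite !(coefD, coefN, coefZ, coefX_deriv, coefXnM) !coefXM/= subn2/=.
  rewrite (Psup nk) (Qsup nk).
  move: nk; rewrite ltnS leq_eqVlt => /predU1P[nk|nk].
    have Qk : Q`_k.+1 = - B^* by rewrite -nk.
    have Pk : P`_k.+1 = 1 by rewrite -nk coefPhi.
    have lk : l = P`_k + A * B^* by rewrite lE nk.
    rewrite Qk Pk /b lk VJ /U nk -natr1; ring.
  rewrite (Psup nk) (Qsup nk).
  move: nk; rewrite ltnS leq_eqVlt => /predU1P[->|nk]; first by ring.
  by rewrite (Psup nk); ring.
- rewrite /T !(coefD, coefN, coef0M, coefZ, coefC, coefX, coefXn)/= P0 Q0.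
  by rewrite /V; ring.
- move=> j jn; rewrite ipT (ipXnPhi_low jn) (@ipQ_low j.+1)//.
  have e0 : (n%:R - j.+1%:R) * ip P 'X^(j.+1) = 0.
    move: jn; rewrite leq_eqVlt => /predU1P[->|jn].
      by rewrite subrr mul0r.
    by rewrite ipXnPhi_low ?mulr0.
  (* For [j = 0] the terms in [ip ('X * P) 1] and [ip Q 1] cancel by the choice of [U]; for larger
     [j] every pairing vanishes. *)
  rewrite e0; case: j jn {e0} => [|j] jn.
    by rewrite expr0 ipXP_1 ipQ_1 /U; ring.
  by rewrite exprS ipX -exprS ipXnPhi_low ?ipQ_low// ?(ltnW jn)//
    ?(ltnW (ltnW jn)); ring.
Qed.

(** Once [T = 0] is known, the further test power ['X^(n.+1)] gives a scalar equation; divided by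
    the norm [h n], it links [b] to its conjugate. *)
Let bJ : b + b^* = - (2 * kap).
Proof.
have bhE : (2 * kap + b) * h n = (l^* + V * A^*) * h n.
  have := ipT n; rewrite T_eq0 ip0l.
  have -> : ip ('X * P) 'X^n = 0.
    have -> : 'X^n = 'X * 'X^(n.-1) :> {poly C} by rewrite -exprS prednK.
    by rewrite ipX ipXnPhi_low// prednK.
  have -> : ip Q 'X^n = 0 by rewrite ipQ_low.
  have -> : ip Q 'X^(n.+1) = A^* * h n.
    rewrite ipQ exprSr -mulrA -[X in ip X]mulr1 ipXn ipC ipXP_1.
    by rewrite rmorphM /= hR.
  rewrite ipPhi_Xn ipP_XnS -natr1 => e; apply/eqP.
  by rewrite -subr_eq0 -oppr_eq0 [X in _ == X]e; apply/eqP; ring.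
have := mulIf (norm_neq0 n) bhE.
have -> : b^* = - l^* - A^* * V.
  by rewrite /b rmorphB rmorphN rmorphM /= conjCK.
by move=> e; rewrite -[X in _ - X]mulrC -opprD -e; ring.
Qed.

Let S1 : 'X * ('X^2 - 1) * P^`() =
  (n%:R%:P * 'X^2 + b%:P * 'X - ((d^*)%:P + n%:R%:P)) * P
  - (U%:P * 'X + V%:P) * Q.
Proof.
apply/eqP; rewrite -subr_eq0 -[X in _ == X]T_eq0 /T; apply/eqP.
by rewrite -!mul_polyC rmorphD; ring.
Qed.

(** Reversing [T = 0] at degree [n + 2] exchanges [P] with [Q] and conjugates the coefficients; the
    terms [n Q] cancel and a factor ['X] is then simplified. *)
Let S2 : ('X^2 - 1) * Q^`() =
  ((b^*)%:P - d%:P * 'X) * Q - ((U^*)%:P + (V^*)%:P * 'X) * P.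
Proof.
pose th := 'X * P^`().
have sth : (size th <= n.+1)%N.
  by apply/leq_sizeP => j nj; rewrite coefX_deriv Psup// mulr0.
have sP : (size P <= n.+1)%N by rewrite sizeP.
have sQ : (size Q <= n.+1)%N by exact: size_rev_conj.
have e0 : 'X * ('X * th) - th = n%:R *: ('X * ('X * P)) + b *: ('X * P)
    - (d^* + n%:R) *: P - U *: ('X * Q) - V *: Q.
  apply/eqP; rewrite -subr_eq0 -[X in _ == X]T_eq0 /T -/th; apply/eqP.
  by rewrite -!mul_polyC; ring.
have rth : rev_conj n th = n%:R *: Q - 'X * Q^`() by exact: rev_conj_deriv.
clearbody th; have := congr1 (rev_conj n.+2) e0.
rewrite !(rev_conjD, rev_conjN, rev_conjZ) !rev_conjSX.
rewrite !rev_conjS ?(leqW sth) ?(leqW sP) ?(leqW sQ)//.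
rewrite (rev_conjK sP) rth -/Q.
have -> : (d^* + n%:R)^* = d + n%:R by rewrite rmorphD /= conjCK rmorph_nat.
rewrite rmorph_nat => e1.
have X0 : 'X != 0 :> {poly C} by rewrite polyX_eq0.
apply: (mulfI X0).
apply/eqP; rewrite -subr_eq0; move/eqP: e1; rewrite -subr_eq0.
set lhs := (X in X == 0 -> _); set rhs := (X in _ -> X == 0).
suff -> : rhs = lhs by [].
by rewrite /lhs /rhs -!mul_polyC rmorphD; ring.
Qed.

(** At such [e] the left sides of [S1] and [S2] vanish, leaving two homogeneous linear equations in
    [P.[e]] and [Q.[e]]. As [P.[e]] is nonzero, their determinant is zero. *)
Let singular e : e * e^* = 1 -> e ^+ 2 = 1 ->
  (b * e - d^*) * (b^* - d * e) = (U * e + V) * (U^* + V^* * e).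
Proof.
move=> ee e2.
have := congr1 (horner^~ e) S1; have := congr1 (horner^~ e) S2.
rewrite !(hornerXn, hornerD, hornerN, hornerM, hornerX, hornerC).
rewrite !e2 subrr !mulr0 !mul0r => h2 h1.
apply: (mulIf (Phi_unit_circle n ee)); rewrite -/P.
have {}h1 : (b * e - d^*) * P.[e] = (U * e + V) * Q.[e].
  by apply/eqP; rewrite -subr_eq0 [X in _ == X]h1; apply/eqP; ring.
have {}h2 : (U^* + V^* * e) * P.[e] = (b^* - d * e) * Q.[e].
  by apply/eqP; rewrite eq_sym -subr_eq0 [X in _ == X]h2; apply/eqP; ring.
by rewrite -mulrA [_ * P.[e]]mulrC mulrA h1 -[RHS]mulrA h2; ring.
Qed.

(** Since [e ^+ 2 = 1], the identity [singular] is [e] times the first equation minus the second, so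
    its cases [e = 1] and [e = -1] separate the two. *)
Let R12 : b * b^* + d * d^* = U * U^* + V * V^* /\
  b * d + b^* * d^* = - (U * V^* + V * U^*).
Proof.
have two : 2 != 0 :> C by rewrite pnatr_eq0.
have e1 : 1 * 1^* = 1 :> C by rewrite rmorph1 mulr1.
have e2 : (-1) * (-1)^* = 1 :> C by rewrite rmorphN rmorph1 mulrNN mulr1.
have p := singular e1 (expr1n _ _).
have m := singular e2 (etrans (sqrrN 1) (expr1n _ _)).
split; apply: (mulfI two).
- transitivity ((b * 1 - d^*) * (b^* - d * 1)
    - (b * -1 - d^*) * (b^* - d * -1)); first by ring.
  by rewrite p m; ring.
- transitivity (- ((b * 1 - d^*) * (b^* - d * 1)
    + (b * -1 - d^*) * (b^* - d * -1))); first by ring.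
  by rewrite p m; ring.
Qed.

Lemma orthogonal_polynomial_ode (e z : C) :
  (d + n%:R + 1) * A * e = (d^* + n%:R) * B ->
  z * (z + e) * (z ^+ 2 - 1) * P^`()^`().[z]
  + (((d + 3 - n%:R) * z ^+ 2 + 2 * kap * z + d^* + n%:R - 1) * (z + e)
     - z * (z ^+ 2 - 1)) * P^`().[z]
  - ((n%:R * (d + 2) * z - (d + n%:R + 1) * l + 2 * n%:R * kap) * (z + e)
     - n%:R * z ^+ 2 + (l + (d + n%:R) * A * B^*) * z + d^* + n%:R) * P.[z]
  = 0.
Proof.
move=> eV; have [r1 r2] := R12.
have S1' : (3 * 'X^2 - 1) * P^`() + 'X * ('X^2 - 1) * P^`()^`() =
    (2 * n%:R%:P * 'X + b%:P) * P
    + (n%:R%:P * 'X^2 + b%:P * 'X - ((d^*)%:P + n%:R%:P)) * P^`()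
    - (U%:P * Q + (U%:P * 'X + V%:P) * Q^`()).
  have := congr1 (@deriv C) S1.
  rewrite !(derivD, derivN, derivM, derivC, derivXn, derivX) => e1.
  apply/eqP; rewrite -subr_eq0; move/eqP: e1; rewrite -subr_eq0.
  set lhs := (X in X == 0 -> _); set rhs := (X in _ -> X == 0).
  suff -> : rhs = lhs by [].
  by rewrite /lhs /rhs; ring.
have r1P : b%:P * (b^*)%:P + d%:P * (d^*)%:P =
    U%:P * (U^*)%:P + V%:P * (V^*)%:P by rewrite -!polyCM -!polyCD r1.
have r2P : b%:P * d%:P + (b^*)%:P * (d^*)%:P =
    - (U%:P * (V^*)%:P + V%:P * (U^*)%:P).
  by rewrite -!polyCM -!polyCD r2 polyCN.
have eVP : U%:P * e%:P = V%:P by rewrite -polyCM /U /V eV.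
(* Eliminating in [{poly C}] allows cancelling ['X^2 - 1] before evaluation, so that [z = 1] and
   [z = -1] are covered. *)
have := second_order_elimination S1 S1' S2 r1P r2P eVP.
have X1 : 'X^2 - 1 != 0 :> {poly C}.
  by rewrite -size_poly_gt0 size_XnsubC.
move/eqP; rewrite mulf_eq0 (negPf X1)/= => /eqP/(congr1 (horner^~ z)).
rewrite !(hornerXn, hornerD, hornerN, hornerM, hornerX, hornerC) => <-.
by rewrite bJ /b VJ /U; ring.
Qed.

End FixedDegree.
End OPUC.

(** * Integration over an interval with singular end points *)

Section FTC.
Local Open Scope classical_set_scope.
Local Open Scope ring_scope.
Context {R : realType}.
Notation mu := (@lebesgue_measure R).
Implicit Types (f F : R -> R) (a b : R).

(** The denominator starts at 3, so that [a + delta < b - delta] already holds for [n = 0]. *)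
Let delta a b (n : nat) : R := (b - a) / n.+3%:R.

Let delta_gt0 a b n : a < b -> 0 < delta a b n.
Proof. by move=> ab; rewrite divr_gt0// subr_gt0. Qed.

Let delta_lt a b n : a < b -> a + delta a b n < b - delta a b n.
Proof.
move=> ab; rewrite -subr_gt0.
have -> : b - delta a b n - (a + delta a b n) = (b - a) * (1 - 2 / n.+3%:R).
  have : (n.+3%:R : R) != 0 by rewrite pnatr_eq0.
  by rewrite /delta; set k := n.+3%:R => k0; field.
rewrite mulr_gt0 ?subr_gt0// ltr_pdivrMr// mul1r ltr_nat//.
Qed.

Let delta_cvg a b : delta a b n @[n --> \oo] --> (0 : R).
Proof.
rewrite -[X in _ --> X](mulr0 (b - a)); apply: cvgMr.
apply: (cvg_trans _ (@cvg_harmonic R)).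
have -> : (fun n : nat => (n.+3%:R : R)^-1) = (@harmonic R) \o (addn 2) by [].
apply: cvg_comp; last exact: cvg_id.
exact: cvg_addnl.
Qed.

Lemma itvoo_FTC2 f F a b : a < b -> continuous F ->
  {in `]a, b[, forall x : R, is_derive x 1 F (f x)} ->
  {in `]a, b[, continuous f} ->
  forall x y, a < x -> x < y -> y < b ->
  (\int[mu]_(t in `[x, y]) (f t)%:E = (F y)%:E - (F x)%:E)%E.
Proof.
move=> ab cF dF cf x y ax xy yb.
have sub z : z \in `[x, y] -> z \in `]a, b[.
  by rewrite !in_itv/= => /andP[? ?]; apply/andP; split; lra.
have sub' z : z \in `]x, y[ -> z \in `]a, b[.
  by rewrite !in_itv/= => /andP[? ?]; apply/andP; split; lra.
apply: continuous_FTC2 => //.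
- apply: continuous_in_subspaceT => z; rewrite inE /= => /sub.
  exact: cf.
- split.
  + by move=> z /sub'/dF[].
  + exact/cvg_at_right_filter/cF.
  + exact/cvg_at_left_filter/cF.
- by move=> z /sub'/dF[? ?]; rewrite derive1E.
Qed.

Lemma measurable_itv_oo f a b (b0 b1 : bool) : {in `]a, b[, continuous f} ->
  measurable_fun [set` Interval (BSide b0 a) (BSide b1 b)] f.
Proof.
move=> cf; have mf : measurable_fun `]a, b[ f.
  apply: open_continuous_measurable_fun => // x; rewrite inE; exact: cf.
case: b0; case: b1 => //.
- exact: measurable_fun_itv_co mf.
- exact: measurable_fun_itv_cc mf.
- exact: measurable_fun_itv_oc mf.
Qed.

(** On the intervals [[a + delta, b - delta]] the integral is an increment of [F], which tends to
    [F b - F a]. Monotone convergence then bounds the whole integral, even if [f] blows up at the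
    end points. *)
Lemma ge0_itv_integrable f F a b : a < b -> continuous F ->
  {in `]a, b[, forall x : R, is_derive x 1 F (f x)} ->
  {in `]a, b[, continuous f} ->
  {in `]a, b[, forall x : R, 0 <= f x} ->
  mu.-integrable `[a, b] (EFin \o f).
Proof.
move=> ab cF dF cf f0.
have mf := measurable_itv_oo cf.
apply/integrableP; split.
  by apply/measurable_EFinP; exact: (mf true false).
rewrite integral_itv_bndoo; last first.
  apply: measurableT_comp => //.
  by apply/measurable_EFinP; exact: (mf false true).
have -> : (\int[mu]_(x in `]a, b[) `|(EFin \o f) x| =
    \int[mu]_(x in `]a, b[) (EFin \o f) x)%E.
  by apply: eq_integral => x; rewrite inE/= => /f0 ?; rewrite ger0_norm.
pose A n := `[a + delta a b n, b - delta a b n]%classic.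
have UA : `]a, b[%classic = \bigcup_n A n.
  apply/seteqP; split => x /=.
    rewrite in_itv/= => /andP[ax xb].
    have d0 : 0 < Num.min (x - a) (b - x) by rewrite lt_min !subr_gt0 ax xb.
    have := delta_cvg a b; move/cvgrPdist_lt => /(_ _ d0)[n _ /(_ n (leqnn n))].
    rewrite /= sub0r normrN gtr0_norm ?delta_gt0// lt_min => /andP[h1 h2].
    exists n => //; rewrite /A /= in_itv/=; apply/andP; split; lra.
  move=> [n _]; rewrite /A /= !in_itv/= => /andP[h1 h2].
  have := delta_gt0 n ab => ?; apply/andP; split; lra.
have subA n x : A n x -> x \in `]a, b[.
  by move=> Anx; have : (\bigcup_n A n) x by [exists n]; rewrite -UA.
have ndA : nondecreasing_seq A.
  move=> m n mn; apply/subsetPset => x; rewrite /A /= !in_itv/= => /andP[h1 h2].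
  have : delta a b n <= delta a b m.
    rewrite /delta ler_pM2l ?subr_gt0// lef_pV2 ?posrE//.
    by rewrite ler_nat.
  by move=> ?; apply/andP; split; lra.
have mfA n : measurable_fun (A n) (EFin \o f).
  apply/measurable_EFinP; apply: measurable_funS (mf false true) => //.
  by move=> x /subA.
have cvgI : (\int[mu]_(x in A n) (EFin \o f) x)%E @[n --> \oo] -->
    (\int[mu]_(x in `]a, b[) (EFin \o f) x)%E.
  rewrite UA; apply: ge0_nondecreasing_set_cvg_integral => //.
  - by move=> n; rewrite /A; exact: measurable_itv.
  - by move=> n x /subA xab; rewrite lee_fin f0.
suff cvgF : (\int[mu]_(x in A n) (EFin \o f) x)%E @[n --> \oo] -->
    (F b - F a)%:E by rewrite (cvg_unique _ cvgI cvgF)// ltry.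
have -> : (fun n => (\int[mu]_(x in A n) (EFin \o f) x)%E) =
    (fun n => (F (b - delta a b n) - F (a + delta a b n))%:E).
  apply/funext => n; rewrite /A (itvoo_FTC2 ab cF dF cf)//.
  - by rewrite ltrDl delta_gt0.
  - exact: delta_lt.
  - by rewrite ltrBlDr ltrDl delta_gt0.
apply: cvg_EFin; first exact: nearW.
apply: cvgB.
- apply: continuous_cvg; first exact: cF.
  rewrite -[X in _ --> X]subr0; apply: cvgB; [exact: cvg_cst|exact: delta_cvg].
- apply: continuous_cvg; first exact: cF.
  rewrite -[X in _ --> X]addr0; apply: cvgD; [exact: cvg_cst|exact: delta_cvg].
Qed.

(** As [f] may be singular at the end points, [F] is compared with the indefinite integral [G]:
    their increments agree inside the interval, both are continuous up to its ends, and a limit is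
    taken on each side of the midpoint [c]. *)
Lemma integrable_FTC2 f F a b : a < b -> continuous F ->
  {in `]a, b[, forall x : R, is_derive x 1 F (f x)} ->
  {in `]a, b[, continuous f} ->
  mu.-integrable `[a, b] (EFin \o f) ->
  \int[mu]_(t in `[a, b]) f t = F b - F a.
Proof.
move=> ab cF dF cf intf.
pose G x := parameterized_integral mu a x f.
have FG x y : a < x -> x < y -> y < b -> G y - G x = F y - F x.
  move=> ax xy yb; rewrite /G /parameterized_integral.
  have iay : mu.-integrable `[a, y] (EFin \o f).
    by apply: integrableS intf => //; apply: subset_itvl; rewrite bnd_simp; lra.
  rewrite Rintegral_itvB ?bnd_simp; [|exact: iay|lra|lra].
  rewrite Rintegral_itv_obnd_cbnd; last first.
    apply: integrableS intf => //; apply: subset_itv; rewrite bnd_simp; lra.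
  by rewrite /Rintegral (itvoo_FTC2 ab cF dF cf).
pose c := (a + b) / 2.
have ac : a < c by rewrite /c; lra.
have cb : c < b by rewrite /c; lra.
have h1 : G c = F c - F a.
  have Ga : G x @[x --> a^'+] --> (0 : R).
    exact/cvg_at_right_filter/(parameterized_integral_cvg_left ab intf).
  have : (F x + (G c - F c)) @[x --> a^'+] --> (F a + (G c - F c)).
    apply: cvgD; [exact/cvg_at_right_filter/cF|exact: cvg_cst].
  have : (F x + (G c - F c)) @[x --> a^'+] --> (0 : R).
    apply: cvg_trans Ga; apply: near_eq_cvg.
    near=> x; have := FG x c; have -> : a < x by near: x; exact: nbhs_right_gt.
    have -> : x < c by near: x; exact: nbhs_right_lt.
    by move=> /(_ isT isT cb) h; lra.
  move=> h h'; have e : (0 : R) = F a + (G c - F c).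
    exact: (cvg_unique (@norm_hausdorff _ _) h h').
  lra.
have h2 : G b - G c = F b - F c.
  have Gb : G x @[x --> b^'-] --> G b.
    exact: (parameterized_integral_cvg_at_left ab intf).
  have : (F x + (G c - F c)) @[x --> b^'-] --> (F b + (G c - F c)).
    apply: cvgD; [exact/cvg_at_left_filter/cF|exact: cvg_cst].
  have : (F x + (G c - F c)) @[x --> b^'-] --> G b.
    apply: cvg_trans Gb; apply: near_eq_cvg.
    near=> x; have := FG c x; have -> : x < b by near: x; exact: nbhs_left_lt.
    have -> : c < x by near: x; exact: nbhs_left_gt.
    by move=> /(_ ac isT isT) h; lra.
  move=> h h'; have e : G b = F b + (G c - F c).
    exact: (cvg_unique (@norm_hausdorff _ _) h h').
  lra.
rewrite -[LHS]/(G b); lra.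
Unshelve. all: by end_near. Qed.

Lemma integrable_itv_cat f a b c : a <= b -> b <= c ->
  mu.-integrable `[a, b] (EFin \o f) -> mu.-integrable `[b, c] (EFin \o f) ->
  mu.-integrable `[a, c] (EFin \o f).
Proof.
move=> ab bc iab ibc'.
have ibc : mu.-integrable `]b, c] (EFin \o f).
  apply: integrableS ibc' => //; exact: subset_itv_oc_cc.
have -> : `[a, c]%classic = `[a, b]%classic `|` `]b, c]%classic.
  by rewrite -itv_bndbnd_setU// bnd_simp.
move/integrableP : iab => [m1 h1]; move/integrableP : ibc => [m2 h2].
have mU : measurable_fun (`[a, b]%classic `|` `]b, c]%classic) (EFin \o f).
  by apply/measurable_funU.
apply/integrableP; split => //.
rewrite ge0_integral_setU//; first exact: lte_add_pinfty.
  exact: measurableT_comp.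
apply/disj_setPS => y [/=]; rewrite 2!in_itv/= => /andP[_ yx] /andP[].
by rewrite ltNge yx.
Qed.

End FTC.

(** * The weight *)

Section Derive.
Local Open Scope classical_set_scope.
Local Open Scope ring_scope.
Context {R : realType}.
Implicit Types (f g : R -> R) (x : R).

Lemma is_derive_continuous f x df : is_derive x 1 f df -> {for x, continuous f}.
Proof. by case=> df1 _; apply/differentiable_continuous/derivable1_diffP. Qed.

Lemma is_derive_mul f g x df dg : is_derive x 1 f df -> is_derive x 1 g dg ->
  is_derive x 1 (fun t => f t * g t) (df * g x + f x * dg).
Proof.
move=> hf hg; apply: (is_derive_eq (is_deriveM hf hg)).
by rewrite addrC; congr (_ + _); exact: mulrC.
Qed.

Lemma is_derive_half x : is_derive x 1 (fun t : R => t / 2) (2^-1).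
Proof.
have h := is_derive_mul (is_derive_id x 1) (is_derive_cst (2^-1 : R) x 1).
by apply: (is_derive_eq h); rewrite mul1r mulr0 addr0.
Qed.

Lemma is_derive_sin_half x :
  is_derive x 1 (fun t : R => sin (t / 2)) (cos (x / 2) / 2).
Proof. exact: (is_derive1_comp (is_derive_sin _) (is_derive_half x)). Qed.

Lemma is_derive_cos_half x :
  is_derive x 1 (fun t : R => cos (t / 2)) (- sin (x / 2) / 2).
Proof. exact: (is_derive1_comp (is_derive_cos _) (is_derive_half x)). Qed.

Lemma sin_half_sq x : sin (x / 2) ^+ 2 = (1 - cos x) / 2.
Proof.
have := cos_mulr2n (x / 2); have := cos2Dsin2 (x / 2).
have -> : x / 2 *+ 2 = x by rewrite -mulr_natr; field.
set c := cos (x / 2); set s := sin (x / 2); rewrite -mulr_natr; lra.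
Qed.

Lemma cos_half_sq x : cos (x / 2) ^+ 2 = (1 + cos x) / 2.
Proof.
have := sin_half_sq x; have := cos2Dsin2 (x / 2).
set c := cos (x / 2); set s := sin (x / 2); lra.
Qed.

Lemma sin_half_angle x : sin x = 2 * sin (x / 2) * cos (x / 2).
Proof.
have := sin_mulr2n (x / 2).
have -> : x / 2 *+ 2 = x by rewrite -mulr_natr; field.
by move=> ->; rewrite -mulr_natr; ring.
Qed.

End Derive.

(* [x (x^2)^p] is, up to the factor [2 p + 1], an antiderivative of
   [(x^2)^p] that is continuous at [0] as soon as [p > -1/2]. *)
Definition oddpow (R : realType) (p x : R) : R := x * (x ^+ 2) `^ p.

Section Oddpow.
Local Open Scope classical_set_scope.
Local Open Scope ring_scope.
Context {R : realType}.
Implicit Types (p x : R).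

Lemma oddpow0 p : oddpow p 0 = 0. Proof. exact: mul0r. Qed.

Lemma is_derive_sqr_powR p x : x != 0 ->
  is_derive x 1 (fun t : R => (t ^+ 2) `^ p)
    (2 * x * (p * (x ^+ 2) `^ (p - 1))).
Proof.
move=> x0; have x20 : 0 < x ^+ 2 by rewrite exprn_even_gt0.
have h2 : is_derive x 1 (fun t : R => t ^+ 2) (2 * x).
  apply: (is_derive_eq (is_derive_mul (is_derive_id x 1) (is_derive_id x 1))).
  ring.
have h := @is_derive1_comp R (@powR R ^~ p) (fun t => t ^+ 2) x _ _
  (is_derive1_powR p x20) h2.
by apply: (is_derive_eq h); rewrite mulrC.
Qed.

Lemma continuous_sqr_powR p x : x != 0 ->
  {for x, continuous (fun t : R => (t ^+ 2) `^ p)}.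
Proof. by move/(is_derive_sqr_powR p)/is_derive_continuous. Qed.

Lemma is_derive_oddpow p x : x != 0 ->
  is_derive x 1 (oddpow p) ((2 * p + 1) * (x ^+ 2) `^ p).
Proof.
move=> x0; have x20 : 0 < x ^+ 2 by rewrite exprn_even_gt0.
have h := is_derive_mul (is_derive_id x 1) (is_derive_sqr_powR p x0).
apply: (is_derive_eq h).
have -> : (x ^+ 2) `^ p = x ^+ 2 * (x ^+ 2) `^ (p - 1).
  have /(@powRD R (x ^+ 2) (p - 1) 1) : (p - 1 + 1 == 0) ==> (x ^+ 2 != 0).
    by rewrite (gt_eqF x20) implybT.
  by rewrite subrK powRr1 ?ltW// mulrC.
ring.
Qed.

Lemma normr_oddpow p x : - (1 / 2) < p ->
  `|oddpow p x| = (x ^+ 2) `^ (p + 2^-1).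
Proof.
move=> p2; have [->|x0] := eqVneq x 0.
  (* A zero base has power 0 only for a nonzero exponent, which the bound on [p] ensures. *)
  rewrite oddpow0 normr0 expr0n/= powR0//.
  by apply/eqP; lra.
rewrite powRD; last by rewrite expf_eq0/= x0 implybT.
by rewrite powR12_sqrt ?sqr_ge0// sqrtr_sqr normrM mulrC ger0_norm ?powR_ge0.
Qed.

Lemma continuous_oddpow p : - (1 / 2) < p -> continuous (oddpow p).
Proof.
move=> p2 x; have [->|x0] := eqVneq x 0; last first.
  exact: is_derive_continuous (is_derive_oddpow p x0).
rewrite /continuous_at oddpow0; apply/cvgrPdist_lt => e e0.
have q0 : 0 < p + 2^-1 by lra.
near=> y; rewrite sub0r normrN normr_oddpow//.
(* With [e] written as a power of the same exponent, monotonicity reduces the estimate to [y ^+ 2]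
   being small. *)
have -> : e = (e `^ (p + 2^-1)^-1) `^ (p + 2^-1).
  by rewrite -powRrM mulVf ?gt_eqF// powRr1// ltW.
apply: gt0_ltr_powR => //; rewrite ?nnegrE ?sqr_ge0 ?powR_ge0//.
near: y.
have : (fun t : R => t ^+ 2) @ (0 : R) --> (0 : R).
  rewrite -[X in _ --> X](expr0n R 2); exact: exprn_continuous.
move/cvgrPdist_lt => /(_ (e `^ (p + 2^-1)^-1)); rewrite powR_gt0// => /(_ isT).
by apply: filterS => y; rewrite sub0r normrN ger0_norm ?sqr_ge0.
Unshelve. all: by end_near. Qed.

End Oddpow.

(** * Integrability of the weight and integration by parts *)

Section Weight.
Local Open Scope classical_set_scope.
Local Open Scope ring_scope.
Context {R : realType}.
Notation mu := (@lebesgue_measure R).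
Variables eta lambda beta : R.
Hypotheses (lambda2 : - (1 / 2) < lambda) (beta2 : - (1 / 2) < beta).

Let w := weight eta lambda beta.
Let sh (t : R) := sin (t / 2).
Let ch (t : R) := cos (t / 2).

Let continuous_sh : continuous sh.
Proof. by move=> t; exact: is_derive_continuous (is_derive_sin_half t). Qed.

Let continuous_ch : continuous ch.
Proof. by move=> t; exact: is_derive_continuous (is_derive_cos_half t). Qed.

Let is_derive_expR_lin (t : R) :
  is_derive t 1 (fun u => expR (- eta * u)) (- eta * expR (- eta * t)).
Proof.
have h : is_derive t 1 (fun u => - eta * u) (- eta).
  have := is_derive_mul (is_derive_cst (- eta : R) t 1) (is_derive_id t 1).
  by move=> h; apply: (is_derive_eq h); rewrite mul0r add0r mulr1.
have := is_derive1_comp (is_derive_expR _) h.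
by move=> {}h; apply: (is_derive_eq h); rewrite mulrC.
Qed.

Lemma weight_ge0 t : 0 <= w t.
Proof. by rewrite !mulr_ge0 ?expR_ge0 ?powR_ge0. Qed.

Lemma weight_gt0 t : sin (t / 2) != 0 -> cos (t / 2) != 0 -> 0 < w t.
Proof.
by move=> s0 c0; rewrite !mulr_gt0 ?expR_gt0 ?powR_gt0 ?exprn_even_gt0.
Qed.

Let continuous_powR_comp (g : R -> R) p t : {for t, continuous g} -> g t != 0 ->
  {for t, continuous (fun u => (g u ^+ 2) `^ p)}.
Proof.
move=> cg g0.
apply: (@continuous_comp _ _ _ g (fun u => (u ^+ 2) `^ p)) => //.
exact: continuous_sqr_powR.
Qed.

Lemma continuous_weight t : sin (t / 2) != 0 -> cos (t / 2) != 0 ->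
  {for t, continuous w}.
Proof.
move=> s0 c0; apply: continuousM; last first.
  by apply: continuous_powR_comp => //; exact: continuous_ch.
apply: continuousM.
  exact: is_derive_continuous (is_derive_expR_lin t).
by apply: continuous_powR_comp => //; exact: continuous_sh.
Qed.

Lemma measurable_weight : measurable_fun setT w.
Proof.
have mp (g : R -> R) p : continuous g ->
    measurable_fun setT (fun u => (g u ^+ 2) `^ p).
  move=> cg; apply: (@measurableT_comp _ _ _ _ _ _ (@powR R ^~ p)) => //.
  apply: continuous_measurable_fun => x.
  exact: (continuous_comp (cg x) (@exprn_continuous _ 2 _)).
apply: measurable_funM; last exact: mp continuous_ch.
apply: measurable_funM; last exact: mp continuous_sh.
apply: continuous_measurable_fun => t.
exact: is_derive_continuous (is_derive_expR_lin t).
Qed.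

Let mul_powR_le_sqrt p (y : R) : - (1 / 2) < p -> 0 <= y -> y <= 1 ->
  y `^ p * y <= Num.sqrt y.
Proof.
move=> p2; rewrite le_eqVlt => /predU1P[<- _|y0 y1].
  by rewrite mulr0 sqrtr_ge0.
have /(@powRD R y p 1) : (p + 1 == 0) ==> (y != 0).
  by rewrite (gt_eqF y0) implybT.
rewrite (powRr1 (ltW y0)) => <-; rewrite -(powR12_sqrt (ltW y0)).
by apply: ger_powR; rewrite ?y0 ?y1//; lra.
Qed.

(* Since [x + y = 1], the product splits as [x^(l+1) y^b + x^l y^(b+1)]. *)
Let powR_split_le (x y : R) : 0 <= x -> 0 <= y -> x + y = 1 ->
  x `^ lambda * y `^ beta <=
  x `^ lambda * Num.sqrt y + y `^ beta * Num.sqrt x.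
Proof.
move=> x0 y0 xy.
have -> : x `^ lambda * y `^ beta =
    x `^ lambda * (y `^ beta * y) + y `^ beta * (x `^ lambda * x).
  rewrite -[LHS]mulr1 -xy; ring.
by rewrite lerD// ler_wpM2l ?powR_ge0// mul_powR_le_sqrt//; lra.
Qed.

(** Each summand has a single kind of singular point, and its other factor makes it, up to sign, a
    constant multiple of the derivative of [oddpow lambda (sh t)] or [oddpow beta (ch t)]. *)
Let majorant (t : R) :=
  (sh t ^+ 2) `^ lambda * `|ch t| + (ch t ^+ 2) `^ beta * `|sh t|.

Let weight_le t : 0 <= t -> t <= 2 * pi ->
  w t <= expR (`|eta| * (2 * pi)) * majorant t.
Proof.
move=> t0 t2; rewrite /w /weight -mulrA ler_pM ?expR_ge0 ?mulr_ge0 ?powR_ge0//.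
  rewrite ler_expR (le_trans (ler_norm _))// normrM normrN (ger0_norm t0).
  by rewrite ler_wpM2l.
rewrite /majorant -!sqrtr_sqr powR_split_le ?sqr_ge0//.
by rewrite addrC cos2Dsin2.
Qed.

(** Here [e] is the sign of [ch], so that [F] is an antiderivative; [2 / (2 * lambda + 1)]
    compensates the factor from [oddpow] and the half angle. *)
Let integrable_sh a b (e : R) : a < b ->
  {in `]a, b[, forall t : R, sh t != 0 /\ `|ch t| = e * ch t} ->
  mu.-integrable `[a, b] (EFin \o (fun t => (sh t ^+ 2) `^ lambda * `|ch t|)).
Proof.
move=> ab h.
pose F t := e * (2 / (2 * lambda + 1)) * oddpow lambda (sh t).
have l0 : 2 * lambda + 1 != 0 by rewrite gt_eqF//; move: lambda2 beta2; lra.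
apply: (@ge0_itv_integrable _ _ F _ _ ab).
- move=> t; apply: cvgM; first exact: cvg_cst.
  apply: (@continuous_comp _ _ _ sh (oddpow lambda)).
    exact: continuous_sh.
  exact: continuous_oddpow.
- move=> t /h[s0 ->].
  have h1 := @is_derive1_comp R (oddpow lambda) sh t _ _
    (is_derive_oddpow lambda s0) (is_derive_sin_half t).
  have := is_derive_mul (is_derive_cst (e * (2 / (2 * lambda + 1)) : R) t 1) h1.
  move=> {}h1; apply: (is_derive_eq h1); rewrite -/(ch t).
  set A := _ `^ _; rewrite mul0r add0r /cst; field.
  by move: l0; rewrite mulrC.
- move=> t /h[s0 _]; apply: cvgM.
    by apply: continuous_powR_comp => //; exact: continuous_sh.
  apply: (@continuous_comp _ _ _ ch (fun x => `|x|)).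
    exact: continuous_ch.
  exact: norm_continuous.
- by move=> t _; rewrite mulr_ge0 ?powR_ge0.
Qed.

Let integrable_ch a b : a < b ->
  {in `]a, b[, forall t : R, ch t != 0 /\ 0 <= sh t} ->
  mu.-integrable `[a, b] (EFin \o (fun t => (ch t ^+ 2) `^ beta * `|sh t|)).
Proof.
move=> ab h.
pose F t := - (2 / (2 * beta + 1)) * oddpow beta (ch t).
have l0 : 2 * beta + 1 != 0 by rewrite gt_eqF//; move: lambda2 beta2; lra.
apply: (@ge0_itv_integrable _ _ F _ _ ab).
- move=> t; apply: cvgM; first exact: cvg_cst.
  apply: (@continuous_comp _ _ _ ch (oddpow beta)).
    exact: continuous_ch.
  exact: continuous_oddpow.
- move=> t /h[c0 s0]; rewrite (ger0_norm s0).
  have h1 := @is_derive1_comp R (oddpow beta) ch t _ _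
    (is_derive_oddpow beta c0) (is_derive_cos_half t).
  have := is_derive_mul (is_derive_cst (- (2 / (2 * beta + 1)) : R) t 1) h1.
  move=> {}h1; apply: (is_derive_eq h1); rewrite -/(sh t).
  set A := _ `^ _; rewrite mul0r add0r /cst; field.
  by move: l0; rewrite mulrC.
- move=> t /h[c0 _]; apply: cvgM.
    by apply: continuous_powR_comp => //; exact: continuous_ch.
  apply: (@continuous_comp _ _ _ sh (fun x => `|x|)).
    exact: continuous_sh.
  exact: norm_continuous.
- by move=> t _; rewrite mulr_ge0 ?powR_ge0.
Qed.

Lemma sin_half_gt0 (t : R) : t \in `]0, (2 * pi)[ -> 0 < sin (t / 2).
Proof. by rewrite in_itv/= => /andP[? ?]; apply: sin_gt0_pi; lra. Qed.

Lemma cos_half_gt0 (t : R) : t \in `]0, pi[ -> 0 < cos (t / 2).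
Proof.
rewrite in_itv/= => /andP[? ?]; have := @pi_gt0 R.
by move=> ?; apply: cos_gt0_pihalf; lra.
Qed.

Lemma cos_half_lt0 (t : R) : t \in `]pi, (2 * pi)[ -> cos (t / 2) < 0.
Proof.
rewrite in_itv/= => /andP[? ?]; rewrite -oppr_gt0 -sinBpihalf.
by apply: sin_gt0_pihalf; lra.
Qed.

(** The weight is dominated by a multiple of [majorant]. Since [ch] must keep a constant sign,
    [[0, pi]] and [[pi, 2 * pi]] are treated separately. *)
Let integrable_weight_on a b (e : R) : 0 <= a -> a < b -> b <= 2 * pi ->
  {in `]a, b[, forall t : R, ch t != 0 /\ `|ch t| = e * ch t} ->
  mu.-integrable `[a, b] (EFin \o w).
Proof.
move=> a0 ab b2 h.
have s0 t : t \in `]a, b[ -> 0 < sh t.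
  rewrite in_itv/= => /andP[? ?]; apply: sin_half_gt0.
  by rewrite in_itv/=; apply/andP; split; lra.
apply: (@le_integrable _ _ _ mu `[a, b]%classic _ (EFin \o w)
  (EFin \o (fun t => expR (`|eta| * (2 * pi)) * majorant t))) => //.
- by apply/measurable_EFinP; apply: measurable_funTS; exact: measurable_weight.
- move=> t /=; rewrite in_itv/= => /andP[? ?].
  rewrite lee_fin ger0_norm ?weight_ge0// ger0_norm.
    by apply: weight_le; lra.
  by rewrite mulr_ge0 ?expR_ge0// addr_ge0// mulr_ge0 ?powR_ge0.
- have -> : EFin \o (fun t => expR (`|eta| * (2 * pi)) * majorant t) =
      (fun t => (expR (`|eta| * (2 * pi)))%:E * (EFin \o majorant) t)%E by [].
  apply: integrableZl => //.
  pose f1 t := (sh t ^+ 2) `^ lambda * `|ch t|.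
  pose f2 t := (ch t ^+ 2) `^ beta * `|sh t|.
  have -> : EFin \o majorant = ((EFin \o f1) \+ (EFin \o f2))%E by [].
  apply: integrableD => //.
  + apply: (@integrable_sh _ _ e) => // t tab.
    by split; [rewrite gt_eqF// s0|case: (h t tab)].
  + apply: integrable_ch => // t tab.
    by split; [case: (h t tab)|rewrite ltW// s0].
Qed.

Let integrable_weight_left : mu.-integrable `[0, pi] (EFin \o w).
Proof.
have pi0 := @pi_gt0 R.
apply: (@integrable_weight_on _ _ 1) => //; first by lra.
by move=> t /cos_half_gt0 c0; rewrite mul1r gtr0_norm// gt_eqF.
Qed.

Let integrable_weight_right : mu.-integrable `[pi, 2 * pi] (EFin \o w).
Proof.
have pi0 := @pi_gt0 R.
apply: (@integrable_weight_on _ _ (- 1)) => //; [lra|lra|].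
by move=> t /cos_half_lt0 c0; rewrite mulN1r ltr0_norm// lt_eqF.
Qed.

Lemma integrable_weight : mu.-integrable `[0, 2 * pi] (EFin \o w).
Proof.
have pi0 := @pi_gt0 R; apply: (@integrable_itv_cat _ _ _ pi); [lra|lra| |].
- exact: integrable_weight_left.
- exact: integrable_weight_right.
Qed.

Lemma integrable_mul_weight (h : R -> R) : continuous h ->
  mu.-integrable `[0, 2 * pi] (EFin \o (fun t => h t * w t)).
Proof.
move=> conth; apply: (@integrableMr _ _ _ mu _ _ h (EFin \o w)) => //.
- by apply: measurable_funTS; exact: continuous_measurable_fun.
- have : compact (h @` `[0, 2 * pi]).
    apply: continuous_compact; last exact: segment_compact.
    exact: continuous_subspaceT.
  move=> /compact_bounded [M [Mr hM]]; exists M; split => // x /hM {}hM y yab.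
  by apply: hM; exists y.
- exact: integrable_weight.
Qed.

(* The derivative of [sin t * T t * weight t]. *)
Let pearson_fun (T T' : R -> R) (t : R) : R :=
  (cos t * T t + sin t * T' t
   + (- eta * sin t + lambda * (1 + cos t) - beta * (1 - cos t)) * T t) * w t.

Let pearson_on (T T' : R -> R) a b : a < b -> sin a = 0 -> sin b = 0 ->
  (forall t : R, is_derive t 1 T (T' t)) -> continuous T' ->
  {in `]a, b[, forall t : R, sh t != 0 /\ ch t != 0} ->
  mu.-integrable `[a, b] (EFin \o pearson_fun T T') ->
  \int[mu]_(t in `[a, b]) pearson_fun T T' t = 0.
Proof.
move=> ab sa sb dT cT' sc0 ifT.
have cT : continuous T by move=> t; exact: is_derive_continuous (dT t).
(* This is [sin t * T t * w t], with the factors of [sin t = 2 * sh t * ch t] absorbed into the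
   powers; it is thus continuous even where the weight is singular. *)
pose F t := 2 * T t *
  (expR (- eta * t) * (oddpow lambda (sh t) * oddpow beta (ch t))).
have Fw t : F t = T t * (sin t * w t).
  by rewrite /F /w /weight sin_half_angle /oddpow -/(sh t) -/(ch t); ring.
rewrite (@integrable_FTC2 _ _ F _ _ ab); last exact: ifT.
- by rewrite !Fw sa sb !mul0r !mulr0 subrr.
- move=> t; apply: cvgM; first by apply: cvgM; [exact: cvg_cst|exact: cT].
  apply: cvgM; first exact: is_derive_continuous (is_derive_expR_lin t).
  apply: cvgM.
    apply: (@continuous_comp _ _ _ sh (oddpow lambda)).
      exact: continuous_sh.
    exact: continuous_oddpow.
  apply: (@continuous_comp _ _ _ ch (oddpow beta)).
    exact: continuous_ch.
  exact: continuous_oddpow.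
- move=> t /sc0[s0 c0].
  have hs := @is_derive1_comp R (oddpow lambda) sh t _ _
    (is_derive_oddpow lambda s0) (is_derive_sin_half t).
  have hc := @is_derive1_comp R (oddpow beta) ch t _ _
    (is_derive_oddpow beta c0) (is_derive_cos_half t).
  have h := is_derive_mul (is_derive_mul (is_derive_cst (2 : R) t 1) (dT t))
    (is_derive_mul (is_derive_expR_lin t) (is_derive_mul hs hc)).
  apply: (is_derive_eq h).
  rewrite /pearson_fun /w /weight /cst /= (sin_half_angle t) /oddpow.
  (* The last term of [pearson_fun] comes from [sin t] times the logarithmic derivative of the
     weight; in half angles the check is a rational identity. *)
  have -> : 1 + cos t = 2 * cos (t / 2) ^+ 2 by rewrite cos_half_sq; field.
  have -> : 1 - cos t = 2 * sin (t / 2) ^+ 2 by rewrite sin_half_sq; field.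
  have -> : cos t = cos (t / 2) ^+ 2 - sin (t / 2) ^+ 2.
    by rewrite cos_half_sq sin_half_sq; field.
  rewrite -/(sh t) -/(ch t).
  set A := _ `^ lambda; set B := _ `^ beta; set E := expR _; by field.
- move=> t tab; have [s0 c0] := sc0 t tab.
  apply: cvgM; last exact: (continuous_weight s0 c0).
  have ct := @continuous_cos R t; have st := @continuous_sin R t.
  apply: cvgD; first by apply: cvgD; apply: cvgM => //; [exact: cT|exact: cT'].
  apply: cvgM; last exact: cT.
  apply: cvgB; last first.
    by apply: cvgM; [exact: cvg_cst|apply: cvgB => //; exact: cvg_cst].
  apply: cvgD; first by apply: cvgM => //; exact: cvg_cst.
  by apply: cvgM; [exact: cvg_cst|apply: cvgD => //; exact: cvg_cst].
Qed.

(* Integration by parts for [sin t * T t], which vanishes at the points where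
   the weight is singular. *)
Lemma weight_pearson (T T' : R -> R) :
  (forall t : R, is_derive t 1 T (T' t)) -> continuous T' ->
  \int[mu]_(t in `[0, 2 * pi])
    ((cos t * T t + sin t * T' t
     + (- eta * sin t + lambda * (1 + cos t) - beta * (1 - cos t)) * T t) * w t)
  = 0.
Proof.
move=> dT cT'.
have cT : continuous T by move=> t; exact: is_derive_continuous (dT t).
have i0 : mu.-integrable `[0, 2 * pi] (EFin \o pearson_fun T T').
  apply: integrable_mul_weight => t.
  have ct := @continuous_cos R t; have st := @continuous_sin R t.
  apply: cvgD; first by apply: cvgD; apply: cvgM => //; [exact: cT|exact: cT'].
  apply: cvgM; last exact: cT.
  apply: cvgB; last first.
    by apply: cvgM; [exact: cvg_cst|apply: cvgB => //; exact: cvg_cst].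
  apply: cvgD; first by apply: cvgM => //; exact: cvg_cst.
  by apply: cvgM; [exact: cvg_cst|apply: cvgD => //; exact: cvg_cst].
have pi0 := @pi_gt0 R.
have s2pi : sin (2 * pi) = 0 :> R by rewrite mulrC mulr_natr sin2pi.
have i1 : mu.-integrable `[0, pi] (EFin \o pearson_fun T T').
  by apply: integrableS i0 => //; apply: subset_itvl; rewrite bnd_simp; lra.
have i2 : mu.-integrable `[pi, 2 * pi] (EFin \o pearson_fun T T').
  by apply: integrableS i0 => //; apply: subset_itvr; rewrite bnd_simp; lra.
have e1 : \int[mu]_(t in `[0, pi]) pearson_fun T T' t = 0.
  apply: pearson_on => //; [exact: sin0|exact: sinpi|] => t t0.
  split; last by rewrite gt_eqF// cos_half_gt0.
  rewrite gt_eqF// sin_half_gt0//; move: t0; rewrite !in_itv/= => /andP[? ?].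
  by apply/andP; split; lra.
have e2 : \int[mu]_(t in `[pi, 2 * pi]) pearson_fun T T' t = 0.
  apply: pearson_on => //; [lra|exact: sinpi|] => t t0.
  split; last by rewrite lt_eqF// cos_half_lt0.
  rewrite gt_eqF// sin_half_gt0//; move: t0; rewrite !in_itv/= => /andP[? ?].
  by apply/andP; split; lra.
have := @Rintegral_itvB R (pearson_fun T T') (BLeft 0) (BRight (2 * pi)) pi i0.
rewrite !bnd_simp Rintegral_itv_obnd_cbnd; last first.
  by apply: integrableS i2 => //; exact: subset_itv_oc_cc.
by rewrite e1 e2 subr0; apply; lra.
Qed.

End Weight.

(** * Trigonometric polynomials *)

Local Notation Re := complex.Re.
Local Notation Im := complex.Im.

Section ComplexDerive.
Local Open Scope classical_set_scope.
Local Open Scope ring_scope.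
Local Open Scope complex_scope.
Context {R : realType}.
Implicit Types (f g : R -> R[i]) (p q : {poly R[i]}).

Lemma cReM (x y : R[i]) : Re (x * y) = Re x * Re y - Im x * Im y.
Proof. by case: x y => [a b] [c d]. Qed.

Lemma cImM (x y : R[i]) : Im (x * y) = Re x * Im y + Im x * Re y.
Proof. by case: x y => [a b] [c d]. Qed.

Lemma cReD (x y : R[i]) : Re (x + y) = Re x + Re y.
Proof. by case: x y => [a b] [c d]. Qed.

Lemma cImD (x y : R[i]) : Im (x + y) = Im x + Im y.
Proof. by case: x y => [a b] [c d]. Qed.

Lemma cReJ (x : R[i]) : Re x^* = Re x. Proof. by case: x. Qed.

Lemma cImJ (x : R[i]) : Im x^* = - Im x. Proof. by case: x. Qed.

Lemma complexP (x y : R[i]) : Re x = Re y -> Im x = Im y -> x = y.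
Proof. by case: x y => [a b] [c d] /= -> ->. Qed.

Definition ccont f :=
  continuous (fun t => Re (f t)) /\ continuous (fun t => Im (f t)).

Definition cderive f f' := forall t : R,
  is_derive t 1 (fun u => Re (f u)) (Re (f' t)) /\
  is_derive t 1 (fun u => Im (f u)) (Im (f' t)).

Lemma cderive_ccont f f' : cderive f f' -> ccont f.
Proof.
move=> df; split=> t; have [h1 h2] := df t;
  [exact: is_derive_continuous h1|exact: is_derive_continuous h2].
Qed.

Lemma ccontD f g : ccont f -> ccont g -> ccont (fun t => f t + g t).
Proof.
move=> [f1 f2] [g1 g2]; split.
- rewrite (funext (fun t => cReD (f t) (g t))) => t.
  by apply: cvgD; [exact: f1|exact: g1].
- rewrite (funext (fun t => cImD (f t) (g t))) => t.
  by apply: cvgD; [exact: f2|exact: g2].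
Qed.

Lemma ccontM f g : ccont f -> ccont g -> ccont (fun t => f t * g t).
Proof.
move=> [f1 f2] [g1 g2]; split.
- rewrite (funext (fun t => cReM (f t) (g t))) => t.
  by apply: cvgB; apply: cvgM; [exact: f1|exact: g1|exact: f2|exact: g2].
- rewrite (funext (fun t => cImM (f t) (g t))) => t.
  by apply: cvgD; apply: cvgM; [exact: f1|exact: g2|exact: f2|exact: g1].
Qed.

Lemma ccontJ f : ccont f -> ccont (fun t => (f t)^*).
Proof.
move=> [f1 f2]; split.
- by rewrite (funext (fun t => cReJ (f t))).
- by rewrite (funext (fun t => cImJ (f t))) => t; apply: cvgN; exact: f2.
Qed.

Lemma ccont_cst (a : R[i]) : ccont (fun=> a).
Proof. by split=> t; exact: cvg_cst. Qed.

Lemma cderiveM f g f' g' : cderive f f' -> cderive g g' ->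
  cderive (fun t => f t * g t) (fun t => f' t * g t + f t * g' t).
Proof.
move=> df dg t; have [f1 f2] := df t; have [g1 g2] := dg t; split.
- rewrite (funext (fun u => cReM (f u) (g u))).
  have h := is_deriveB (is_derive_mul f1 g1) (is_derive_mul f2 g2).
  apply: (is_derive_eq h).
  by rewrite cReD !cReM; ring.
- rewrite (funext (fun u => cImM (f u) (g u))).
  have h := is_deriveD (is_derive_mul f1 g2) (is_derive_mul f2 g1).
  apply: (is_derive_eq h).
  by rewrite cImD !cImM; ring.
Qed.

Lemma cderiveD f g f' g' : cderive f f' -> cderive g g' ->
  cderive (fun t => f t + g t) (fun t => f' t + g' t).
Proof.
move=> df dg t; have [f1 f2] := df t; have [g1 g2] := dg t; split.
- by rewrite (funext (fun u => cReD (f u) (g u))) cReD; exact: is_deriveD.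
- by rewrite (funext (fun u => cImD (f u) (g u))) cImD; exact: is_deriveD.
Qed.

Lemma cderiveJ f f' : cderive f f' ->
  cderive (fun t => (f t)^*) (fun t => (f' t)^*).
Proof.
move=> df t; have [f1 f2] := df t; split.
- by rewrite (funext (fun u => cReJ (f u))) cReJ.
- by rewrite (funext (fun u => cImJ (f u))) cImJ; exact: is_deriveN.
Qed.

Lemma cderive_cst (a : R[i]) : cderive (fun=> a) (fun=> 0).
Proof. by move=> t; split; exact: is_derive_cst. Qed.

Lemma cderive_expi : cderive (@expi R) (fun t => 'i * expi t).
Proof.
move=> t; split => /=.
- by apply: (is_derive_eq (is_derive_cos t)); rewrite mul0r mul1r sub0r.
- by apply: (is_derive_eq (is_derive_sin t)); rewrite mul0r mul1r add0r.
Qed.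

Lemma cderive_horner p :
  cderive (fun t => p.[expi t]) (fun t => 'i * expi t * p^`().[expi t]).
Proof.
elim/poly_ind: p => [|p c IH].
  have := @cderive_cst 0.
  by congr cderive; apply/funext => t; rewrite ?deriv0 !horner0 ?mulr0.
have := cderiveD (cderiveM IH cderive_expi) (cderive_cst c).
congr cderive; apply/funext => t; first by rewrite hornerMXaddC.
rewrite derivD derivM derivX derivC.
rewrite !addr0 mulr1 hornerD hornerMX; ring.
Qed.

Lemma ccont_horner p : ccont (fun t => p.[expi t]).
Proof. exact: cderive_ccont (cderive_horner p). Qed.

Lemma expiJ (t : R) : expi t * (expi t)^* = 1.
Proof.
apply: complexP; rewrite ?cReM ?cImM cReJ cImJ /=; last by ring.
by rewrite mulrN opprK -!expr2 cos2Dsin2.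
Qed.

End ComplexDerive.

(** * The inner product of the weight *)

Local Open Scope complex_scope.

(* Depending on the scope, [^*] denotes either conjugation. *)
Lemma conjCE (R : realType) (x : R[i]) : (x^*)%R = x^*%C.
Proof. by []. Qed.

Section Inner.
Local Open Scope classical_set_scope.
Local Open Scope ring_scope.
Local Open Scope complex_scope.
Context {R : realType}.
Notation mu := (@lebesgue_measure R).
Variables eta lambda beta : R.
Hypotheses (lambda2 : - (1 / 2) < lambda) (beta2 : - (1 / 2) < beta).
Implicit Types (f g : R -> R[i]) (p q r : {poly R[i]}).

Let w := weight eta lambda beta.
Let mom f := cintegral (fun t => f t * (w t)%:C).

Let integrable_w (h : R -> R) : continuous h ->
  mu.-integrable `[0, 2 * pi] (EFin \o (fun t => h t * w t)).
Proof. exact: integrable_mul_weight. Qed.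

Let momE f : mom f =
  (\int[mu]_(t in `[0, 2 * pi]) (Re (f t) * w t)) +i*
  (\int[mu]_(t in `[0, 2 * pi]) (Im (f t) * w t)).
Proof.
rewrite /mom /cintegral; congr (_ +i* _); apply: eq_Rintegral => t _.
- by rewrite cReM /= mulr0 subr0.
- by rewrite cImM /= mulr0 add0r.
Qed.

Let momD f g : ccont f -> ccont g -> mom (fun t => f t + g t) = mom f + mom g.
Proof.
move=> [f1 f2] [g1 g2]; rewrite !momE; apply: complexP => /=.
- under eq_Rintegral do rewrite cReD mulrDl.
  by rewrite RintegralD//; exact: integrable_w.
- under eq_Rintegral do rewrite cImD mulrDl.
  by rewrite RintegralD//; exact: integrable_w.
Qed.

Let Rintegral_wZ (a : R) (h : R -> R) : continuous h ->
  \int[mu]_(t in `[0, 2 * pi]) (a * h t * w t) =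
  a * \int[mu]_(t in `[0, 2 * pi]) (h t * w t).
Proof.
move=> conth; under eq_Rintegral do rewrite -mulrA.
by rewrite RintegralZl//; exact: integrable_w.
Qed.

Let momZ (a : R[i]) f : ccont f -> mom (fun t => a * f t) = a * mom f.
Proof.
move=> [f1 f2]; rewrite !momE.
have cM (b : R) (h : R -> R) : continuous h -> continuous (fun t => b * h t).
  by move=> conth t; apply: cvgM; [exact: cvg_cst|exact: conth].
apply: complexP; rewrite ?cReM ?cImM /=.
- under eq_Rintegral do rewrite cReM mulrBl.
  by rewrite RintegralB ?Rintegral_wZ//; apply: integrable_w; exact: cM.
- under eq_Rintegral do rewrite cImM mulrDl.
  by rewrite RintegralD ?Rintegral_wZ//; apply: integrable_w; exact: cM.
Qed.

Let momJ f : ccont f -> mom (fun t => (f t)^*) = (mom f)^*.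
Proof.
move=> [f1 f2]; rewrite !momE; apply: complexP => /=.
- by apply: eq_Rintegral => t _; rewrite cReJ.
- under eq_Rintegral do rewrite cImJ mulNr -mulN1r.
  by rewrite RintegralZl ?mulN1r//; exact: integrable_w.
Qed.

Let mom_pearson T T' : cderive T T' -> ccont T' ->
  mom (fun t => (cos t)%:C * T t + (sin t)%:C * T' t
    + (- eta * sin t + lambda * (1 + cos t) - beta * (1 - cos t))%:C * T t) = 0.
Proof.
move=> dT [c1 c2]; rewrite momE; apply: complexP => /=.
- rewrite -[RHS](@weight_pearson R eta lambda beta lambda2 beta2
    (fun t => Re (T t)) (fun t => Re (T' t)))//; last by move=> t; case: (dT t).
  by apply: eq_Rintegral => t _; rewrite !cReD !cReM /= !mul0r !subr0.
- rewrite -[RHS](@weight_pearson R eta lambda beta lambda2 beta2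
    (fun t => Im (T t)) (fun t => Im (T' t)))//; last by move=> t; case: (dT t).
  by apply: eq_Rintegral => t _; rewrite !cImD !cImM /= !mul0r !addr0.
Qed.

Definition ip p q := inner w (horner p) (horner q).

Let ipE p q : ip p q = mom (fun t => p.[expi t] * (q.[expi t])^*).
Proof. by []. Qed.

Let ccont_ip p q : ccont (fun t => p.[expi t] * (q.[expi t])^*).
Proof. by apply: ccontM; [|apply: ccontJ]; exact: ccont_horner. Qed.

Lemma ipDl p q r : ip (p + q) r = ip p r + ip q r.
Proof.
rewrite !ipE -momD; [|exact: ccont_ip..].
by congr mom; apply/funext => t; rewrite hornerD mulrDl.
Qed.

Lemma ipZl a p q : ip (a *: p) q = a * ip p q.
Proof.
rewrite !ipE -momZ; last exact: ccont_ip.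
by congr mom; apply/funext => t; rewrite hornerZ mulrA.
Qed.

Lemma ipC p q : ip q p = (ip p q)^*.
Proof.
rewrite !ipE -momJ; last exact: ccont_ip.
by congr mom; apply/funext => t; rewrite rmorphM /= conjcK mulrC.
Qed.

Lemma ipX p q : ip ('X * p) ('X * q) = ip p q.
Proof.
rewrite !ipE; congr mom; apply/funext => t.
by rewrite !hornerM hornerX rmorphM /= mulrACA expiJ mul1r.
Qed.

(** With [z = expi t], [2 z cos t = z^2 + 1] and [2 z sin t = - i (z^2 - 1)]. Taking
    [T = 2 z p(z) conj (q(z))] in [mom_pearson] therefore turns the trigonometric coefficients into
    polynomials in [z]. *)
Lemma ip_pearson p q (d := (lambda + beta) +i* eta) :
  ip (('X^2 - 1) * ('X * p^`())) q - ip (('X^2 - 1) * p) ('X * q^`())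
  + ip (((d + 2)%:P * 'X^2 + (2 * (lambda - beta)%:C)%:P * 'X + (d^*)%:P) * p) q
  = 0.
Proof.
have hT := cderiveM (cderiveM (cderive_expi (R := R)) (cderive_horner (2 *: p)))
  (cderiveJ (cderive_horner q)).
have ce : ccont (@expi R) := cderive_ccont (cderive_expi (R := R)).
have ice : ccont (fun t : R => 'i * expi t).
  by apply: ccontM => //; exact: ccont_cst.
have -> : - ip (('X^2 - 1) * p) ('X * q^`()) =
    ip ((-1) *: (('X^2 - 1) * p)) ('X * q^`()) by rewrite ipZl mulN1r.
rewrite !ipE -momD; [|exact: ccont_ip..].
rewrite -momD; [|by apply: ccontD; exact: ccont_ip|exact: ccont_ip].
rewrite -[RHS](mom_pearson hT); last first.
  apply: ccontD; apply: ccontM.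
  + by apply: ccontD; apply: ccontM => //; [exact: ccont_horner|
      apply: ccontM => //; exact: ccont_horner].
  + by apply: ccontJ; exact: ccont_horner.
  + by apply: ccontM => //; exact: ccont_horner.
  + by apply: ccontJ; apply: ccontM => //; exact: ccont_horner.
congr mom; apply/funext => t.
rewrite !conjCE.
have -> : ('i * expi t * q^`().[expi t])^*%C =
    - 'i * (expi t)^*%C * (q^`().[expi t])^*%C.
  by rewrite !rmorphM; congr (_ * _ * _); apply: complexP; rewrite /= ?oppr0.
have -> : ((('X : {poly R[i]}) * q^`()).[expi t])^*%C =
    (expi t)^*%C * (q^`().[expi t])^*%C.
  by rewrite hornerM hornerX rmorphM.
rewrite derivZ.
rewrite !(hornerZ, hornerD, hornerM, hornerN, hornerX, hornerXn, hornerC).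
have -> : (- eta * sin t + lambda * (1 + cos t) - beta * (1 - cos t))%:C =
    - eta%:C * (sin t)%:C + lambda%:C * (1 + (cos t)%:C)
    - beta%:C * (1 - (cos t)%:C).
  by rewrite !(rmorphB, rmorphD, rmorphM, rmorphN).
have -> : d = lambda%:C + beta%:C + 'i * eta%:C.
  by apply: complexP; rewrite /d /=; ring.
have -> : (lambda%:C + beta%:C + 'i * eta%:C)^* =
    lambda%:C + beta%:C - 'i * eta%:C by apply: complexP; rewrite /=; ring.
have -> : (lambda - beta)%:C = lambda%:C - beta%:C by rewrite rmorphB.
have -> : expi t = (cos t)%:C + 'i * (sin t)%:C.
  by apply: complexP; rewrite /=; ring.
have -> : ((cos t)%:C + 'i * (sin t)%:C)^*%C = (cos t)%:C - 'i * (sin t)%:C.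
  by apply: complexP; rewrite /=; ring.
(* Both integrands are now polynomial in [cos t], [sin t] and ['i], and agree modulo the relations
   [ss] and [ii]. *)
have ss : (sin t)%:C ^+ 2 = 1 - (cos t)%:C ^+ 2 :> R[i].
  by rewrite -!rmorphXn -(rmorph1 (real_complex R)) -rmorphB /= sin2cos2.
have ii : ('i : R[i]) * 'i = -1 by rewrite -expr2 sqr_i.
rewrite !expr2 in ss; ring: ii ss.
Qed.

End Inner.

(** * Positivity of integrals *)

Section Positivity.
Local Open Scope classical_set_scope.
Local Open Scope ring_scope.
Context {R : realType}.
Notation mu := (@lebesgue_measure R).

(** By continuity [f >= f c / 2] on a closed interval of radius [r] around [c], which contributes at
    least [f c * r]. *)
Lemma Rintegral_itv_gt0 (f : R -> R) (a b c : R) :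
  mu.-integrable `[a, b] (EFin \o f) ->
  {in `[a, b], forall t : R, 0 <= f t} ->
  c \in `]a, b[ -> {for c, continuous f} -> 0 < f c ->
  0 < \int[mu]_(t in `[a, b]) f t.
Proof.
move=> intf f0; rewrite in_itv/= => /andP[ac cb] cf fc.
have fc2 : 0 < f c / 2 by rewrite divr_gt0.
have /cvgrPdist_lt /(_ _ fc2) := cf.
move=> /nbhs_ballP[e /= e0 he].
(* The bound [e / 2] puts the closed interval inside the open ball of radius [e]; the other two keep
   it inside [[a, b]]. *)
pose r := Num.min (e / 2) (Num.min (c - a) (b - c)).
have r0 : 0 < r by rewrite !lt_min divr_gt0//= !subr_gt0 ac cb.
have [re [ra rb]] : r <= e / 2 /\ r <= c - a /\ r <= b - c.
  by rewrite /r; split; [|split]; rewrite !ge_min lexx ?orbT.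
pose D : set R := `[c - r, c + r]%classic.
have mD : measurable D by exact: measurable_itv.
have DI : D `<=` `[a, b]%classic.
  by apply: subset_itv; rewrite bnd_simp; lra.
have iD : mu.-integrable D (EFin \o f).
  by rewrite /D; apply: integrableS intf => //.
have h1 : f c / 2 * (2 * r) <= \int[mu]_(t in D) f t.
  have fge t : D t -> f c / 2 <= f t.
    rewrite /D /= in_itv/= => /andP[t1 t2].
    have : ball c e t by rewrite /ball/= ltr_norml; apply/andP; split; lra.
    by move/he; rewrite /= ltr_norml => /andP[? ?]; lra.
  have -> : f c / 2 * (2 * r) = \int[mu]_(t in D) (f c / 2).
    have muD : mu D = (2 * r)%:E.
      rewrite /D lebesgue_measure_itv/= lte_fin.
      by have -> : c - r < c + r by [lra]; rewrite -EFinD; congr (_%:E); ring.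
    by rewrite Rintegral_cst//; congr (_ * _); exact: (esym (congr1 fine muD)).
  apply: le_Rintegral => //.
  apply: (@le_integrable _ _ _ mu D _ (EFin \o (fun=> f c / 2))
    (EFin \o f)) => //.
    by apply/measurable_EFinP; exact: measurable_cst.
  move=> t Dt /=; rewrite lee_fin gtr0_norm// ger0_norm ?fge//.
  by rewrite (le_trans (ltW fc2))// fge.
apply: lt_le_trans (_ : \int[mu]_(t in D) f t <= _).
  by apply: lt_le_trans h1; rewrite !mulr_gt0.
rewrite /Rintegral fine_le//; [exact: integrable_fin_num..|].
apply: ge0_subset_integral => //; exact: (measurable_int mu intf).
Qed.

End Positivity.

(** * Definiteness of the inner product *)

Section Definite.
Local Open Scope classical_set_scope.
Local Open Scope ring_scope.
Local Open Scope complex_scope.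
Context {R : realType}.
Variables eta lambda beta : R.
Hypotheses (lambda2 : - (1 / 2) < lambda) (beta2 : - (1 / 2) < beta).
Implicit Types (p : {poly R[i]}).

(** As [expi] is injective on []0, pi[], a polynomial vanishing along this arc has too many roots.
    The open interval also avoids the points where the weight may be singular. *)
Lemma horner_expi_neq0 p : p != 0 ->
  exists2 t : R, t \in `]0, pi[ & p.[expi t] != 0.
Proof.
move=> p0; apply: contrapT => h.
(* These are [size p] points, one more than the degree; the shift to [k.+2] keeps the angles
   strictly below [pi]. *)
pose s := [seq expi (pi / k.+2%:R : R) | k <- iota 0 (size p)].
have inpi k : (pi / k.+2%:R : R) \in `]0, pi[.
  rewrite in_itv/= divr_gt0 ?pi_gt0//= ltr_pdivrMr// ltr_pMr ?pi_gt0//.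
  by rewrite ltr1n.
have rs : all (root p) s.
  apply/allP => _ /mapP[k _ ->]; apply/negPn/negP => pk; apply: h.
  by exists (pi / k.+2%:R).
have us : uniq s.
  rewrite map_inj_uniq ?iota_uniq// => j k [] /cos_inj.
  have sub x : x \in `]0, pi[ -> x \in `[0, pi] :> bool.
    by move=> hx; apply: subset_itv_oo_cc hx.
  rewrite !sub ?inpi// => /(_ isT isT) /(mulfI _).
  rewrite gt_eqF ?pi_gt0// => /(_ isT) /invr_inj /eqP.
  by rewrite eqr_nat => /eqP[].
have := max_poly_roots p0 rs us.
by rewrite size_map size_iota ltnn.
Qed.

(** For nonzero [p], the nonnegative function [|p|^2 w] is continuous and positive at some point of
    []0, pi[], hence has a positive integral. *)
Lemma ip_eq0 p : ip eta lambda beta p p = 0 -> p = 0.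
Proof.
move=> /(congr1 (@complex.Re R)) /= h.
apply/eqP; apply: contraT => /horner_expi_neq0[c c0 pc].
pose g t := Re (p.[expi t] * (p.[expi t])^*).
have gE t : g t = Re (p.[expi t]) ^+ 2 + Im (p.[expi t]) ^+ 2.
  by rewrite /g cReM cReJ cImJ mulrN opprK !expr2.
have [cg _] : ccont (fun t => p.[expi t] * (p.[expi t])^*).
  by apply: ccontM; [|apply: ccontJ]; exact: ccont_horner.
have g0 t : 0 <= g t by rewrite gE addr_ge0 ?sqr_ge0.
have c2 : c \in `]0, (2 * pi)[.
  move: c0; rewrite !in_itv/= => /andP[? ?]; apply/andP; split => //.
  by have := @pi_gt0 R; lra.
have sc : sin (c / 2) != 0 by rewrite gt_eqF// sin_half_gt0.
have cc : cos (c / 2) != 0 by rewrite gt_eqF// cos_half_gt0.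
suff : 0 < \int[lebesgue_measure]_(t in `[0, 2 * pi])
    (g t * weight eta lambda beta t).
  rewrite [X in 0 < X](_ : _ = 0) ?ltxx// -[RHS]h.
  by apply: eq_Rintegral => t _; rewrite cReM /= mulr0 subr0.
apply: (@Rintegral_itv_gt0 _ _ _ _ c) => //.
- exact: integrable_mul_weight.
- by move=> t _; rewrite mulr_ge0// weight_ge0.
- by apply: cvgM; [exact: cg|exact: continuous_weight].
- rewrite mulr_gt0 ?weight_gt0// lt_neqAle g0 andbT eq_sym gE.
  rewrite paddr_eq0 ?sqr_ge0// !sqrf_eq0.
  apply: contra pc => /andP[/eqP r0 /eqP i0].
  by apply/eqP; apply: complexP.
Qed.

End Definite.

(** * The differential equation for the given weight *)

Theorem corollary4p20 (R : realType) (eta lambda beta : R)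
    (Phi : nat -> {poly R[i]}) (n : nat) (eps : R[i]) :
  - (1 / 2) < lambda -> - (1 / 2) < beta ->
  monic_OPUC (weight eta lambda beta) Phi ->
  (1 <= n)%N ->
  let d : R[i] := (lambda + beta) +i* eta in
  let alpha : int -> R[i] := verblunsky Phi in
  let l : R[i] := (Phi n.+1)`_n in
  alpha n%:Z <> 0 ->
  (d + n%:R + 1) * (alpha n%:Z)^* * eps =
    (d^* + n%:R) * (alpha (n%:Z - 1))^* ->
  let p3 (z : R[i]) : R[i] :=
    ((d + 3 - n%:R) * z ^+ 2 + 2 * (lambda - beta)%:C * z + d^* + n%:R - 1)
      * (z + eps) - z * (z ^+ 2 - 1) in
  let p2 (z : R[i]) : R[i] :=
    (n%:R * (d + 2) * z - (d + n%:R + 1) * l - 2 * n%:R * (beta - lambda)%:C)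
      * (z + eps) - n%:R * z ^+ 2
    + (l + (d + n%:R) * (alpha n%:Z)^* * alpha (n%:Z - 1)) * z
    + d^* + n%:R in
  forall z : R[i],
    z * (z + eps) * (z ^+ 2 - 1) * (Phi n)^`()^`().[z]
      + p3 z * (Phi n)^`().[z] - p2 z * (Phi n).[z] = 0.
Proof.
move=> lambda2 beta2 [hPhi orthPhi] n_gt0 d alpha l _ heps p3 p2 z.
have monicPhi m : Phi m \is monic by case: (hPhi m).
have sizePhi m : size (Phi m) = m.+1 by case: (hPhi m).
have alphaE : alpha n%:Z = - ((Phi n.+1)`_0)^*.
  by rewrite /alpha /= horner_coef0.
(* As [n >= 1], the index [n - 1] is the natural number [n.-1], so the conventional value at [-1]
   does not occur. *)
have alpha1E : alpha (n%:Z - 1) = - ((Phi n)`_0)^*.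
  rewrite -(prednK n_gt0) -addn1 PoszD addrK /alpha/= horner_coef0.
  by rewrite addn1 prednK.
have conj0 : (alpha n%:Z)^* = - (Phi n.+1)`_0.
  by rewrite alphaE rmorphN /= conjcK.
have conj1 : (alpha (n%:Z - 1))^* = - (Phi n)`_0.
  by rewrite alpha1E rmorphN /= conjcK.
have pearson p q : ip eta lambda beta (('X^2 - 1) * ('X * p^`())) q
    - ip eta lambda beta (('X^2 - 1) * p) ('X * q^`())
    + ip eta lambda beta (((d + 2)%:P * 'X^2 + (2 * (lambda - beta)%:C)%:P * 'X
        + (d^*)%:P) * p) q = 0 by exact: ip_pearson.
rewrite !conjCE conj0 conj1 in heps.
have := @orthogonal_polynomial_ode R[i] (ip eta lambda beta)
  (ipDl eta lambda2 beta2) (ipZl eta lambda2 beta2) (ipC eta lambda2 beta2)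
  (ipX eta lambda beta) (ip_eq0 lambda2 beta2 (eta := eta))
  Phi monicPhi sizePhi orthPhi n n_gt0 d (lambda - beta)%:C pearson eps z heps.
rewrite -/l => ode; rewrite -[RHS]ode /p3 /p2 !conjCE conj0 alpha1E.
have -> : (beta - lambda)%:C = - (lambda - beta)%:C :> R[i].
  by rewrite -rmorphN opprB.
have -> : (- (Phi n)`_0)^*%C = - ((Phi n)`_0)^*%C by rewrite rmorphN.
ring.
Qed.
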